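(* Let $A$ and $B$ be linear differential operators on $\mathbb R^d$. If $A$ is a differential pre-transmutation of $B$ and if $B$ is hypoelliptic, then $A$ is hypoelliptic.
   Context: Let $d,n,m,p,q\in\mathbb N^*$. A linear differential operator on $\mathbb R^d$ is a finite-order linear differential operator $\sum_{|\alpha|\le k}C_\alpha(x)\partial^\alpha$ with $C^\infty$ matrix-valued coefficients on $\mathbb R^d$. Here $A: \mathcal E\to\mathcal F$, $B:\mathcal G\to\mathcal H$ with $\mathcal E=C^\infty(\mathbb R^d;\mathbb R^n)$, $\mathcal F=C^\infty(\mathbb R^d;\mathbb R^m)$, $\mathcal G=C^\infty(\mathbb R^d;\mathbb R^p)$, $\mathcal H=C^\infty(\mathbb R^d;\mathbb R^q)$. Such operators also act on (vector-valued) smooth functions and distributions on any open subset of $\mathbb R^d$. $A$ is a differential pre-transmutation of $B$ if there are linear differential operators with $C^\infty$ coefficients $P:\mathcal G\to\mathcal E$, $Q:\mathcal E\to\mathcal G$, $S:\mathcal F\to\mathcal H$, $T:\mathcal F\to\mathcal E$ such that $BQ=SA$ and $PQ+TA=\mathrm{Id}_{\mathcal E}$. A linear differential operator $A$ is hypoelliptic if for any non-empty open subset $\Omega$ of $\mathbb R^d$, any $f$ which is $C^\infty$ in $\Omega$, and any distribution $u$ on $\Omega$ satisfying $Au=f$ in $\Omega$, $u$ is $C^\infty$ in $\Omega$. *)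

(* Defs.v *)
From HB Require Import structures.
From mathcomp Require Import all_boot all_order all_algebra.
From mathcomp Require Import all_classical all_reals all_analysis.

Set Implicit Arguments.
Unset Strict Implicit.
Unset Printing Implicit Defensive.

Import Order.TTheory GRing.Theory Num.Theory.
Import numFieldNormedType.Exports.

Local Open Scope classical_set_scope.
Local Open Scope ring_scope.

Section PartialDerivatives.
Context {R : realType} {d : nat}.

Definition partial (i : 'I_d) (f : 'rV[R]_d -> R) : 'rV[R]_d -> R :=
  fun x => 'D_(delta_mx 0 i) f x.

Definition partialX (a : 'I_d -> nat) (f : 'rV[R]_d -> R) : 'rV[R]_d -> R :=
  foldr (fun i g => iter (a i) (partial i) g) f (enum 'I_d).

(* Functions on an open set Omega are represented by total functions whose
   values outside Omega are irrelevant. *)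
Fixpoint Ck (Omega : set 'rV[R]_d) (k : nat) (f : 'rV[R]_d -> R) : Prop :=
  (forall x, Omega x -> {for x, continuous f}) /\
  if k is k'.+1 then
    forall i : 'I_d, (forall x, Omega x -> derivable f x (delta_mx 0 i)) /\
                     Ck Omega k' (partial i f)
  else True.

Definition smooth (Omega : set 'rV[R]_d) (f : 'rV[R]_d -> R) : Prop :=
  forall k, Ck Omega k f.

Definition smoothv (n : nat) (Omega : set 'rV[R]_d)
  (f : 'rV[R]_d -> 'cV[R]_n) : Prop :=
  forall i, smooth Omega (fun x => f x i 0).

(* The sum of F a over all multi-indices a of length |a| <= k. *)
Definition sum_mindex (V : nmodType) (k : nat) (F : ('I_d -> nat) -> V) : V :=
  \sum_(a : {ffun 'I_d -> 'I_k.+1} | (\sum_i a i <= k)%N)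
    F (fun i => nat_of_ord (a i)).

End PartialDerivatives.

(* Integral over R^d as an iterated Lebesgue integral; it is only applied to
   continuous functions with compact support, for which Fubini's theorem
   identifies it with the integral against d-dimensional Lebesgue measure. *)
Fixpoint integral_Rd (R : realType) (d : nat) : ('rV[R]_d -> R) -> R :=
  match d with
  | 0 => fun f => f 0
  | d'.+1 => fun f =>
      \int[@lebesgue_measure R]_(t in [set: R])
        integral_Rd (fun y : 'rV[R]_d' => f (row_mx (t%:M : 'rV[R]_1) y))
  end.

Section Distributions.
Context {R : realType} {d : nat}.

Definition test_in (K : set 'rV[R]_d) (phi : 'rV[R]_d -> R) : Prop :=
  smooth [set: 'rV[R]_d] phi /\ forall x, ~ K x -> phi x = 0.

(* C_c^oo(Omega), each function being extended by 0 outside Omega. *)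
Definition test (Omega : set 'rV[R]_d) (phi : 'rV[R]_d -> R) : Prop :=
  exists K : set 'rV[R]_d, [/\ compact K, K `<=` Omega & test_in K phi].

(* Only the values of u on C_c^oo(Omega) are relevant. *)
Definition is_distribution (Omega : set 'rV[R]_d)
  (u : ('rV[R]_d -> R) -> R) : Prop :=
  (forall (c : R) phi psi, test Omega phi -> test Omega psi ->
     u (fun x => c * phi x + psi x) = c * u phi + u psi) /\
  (forall K : set 'rV[R]_d, compact K -> K `<=` Omega ->
     exists (C : R) (N : nat), forall phi, test_in K phi ->
       `|u phi| <=
         C * sum_mindex N (fun a => sup (range (fun x => `|partialX a phi x|)))).

(* The vector-valued distribution u on Omega is the one defined by the
   (locally integrable) function g. *)
Definition dist_eq_fun (n : nat) (Omega : set 'rV[R]_d)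
  (u : 'I_n -> ('rV[R]_d -> R) -> R) (g : 'rV[R]_d -> 'cV[R]_n) : Prop :=
  forall i phi, test Omega phi ->
    u i phi = integral_Rd (fun x => g x i 0 * phi x).

End Distributions.

(* The operator \sum_(|a| <= dorder) dcoef a x * d^a, from functions with values
   in R^n to functions with values in R^m. *)
Record diffop (R : realType) (d n m : nat) := DiffOp {
  dorder : nat;
  dcoef : ('I_d -> nat) -> 'rV[R]_d -> 'M[R]_(m, n);
  smooth_dcoef : forall a i j, smooth [set: 'rV[R]_d] (fun x => dcoef a x i j)
}.

Section Operators.
Context {R : realType} {d : nat}.

Definition apply_fun (n m : nat) (A : diffop R d n m)
  (f : 'rV[R]_d -> 'cV[R]_n) : 'rV[R]_d -> 'cV[R]_m :=
  fun x => sum_mindex (dorder A) (fun a =>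
    dcoef A a x *m \col_j partialX a (fun y => f y j 0) x).

(* (c d^a v)(phi) = (-1)^|a| v(d^a (c phi)) for a scalar distribution v and a
   smooth coefficient c. *)
Definition apply_dist (n m : nat) (A : diffop R d n m)
  (u : 'I_n -> ('rV[R]_d -> R) -> R) : 'I_m -> ('rV[R]_d -> R) -> R :=
  fun i phi => sum_mindex (dorder A) (fun a =>
    (-1) ^+ (\sum_k a k)%N *
      \sum_j u j (partialX a (fun x => dcoef A a x i j * phi x))).

Definition differential_pretransmutation (n m p q : nat)
  (A : diffop R d n m) (B : diffop R d p q) : Prop :=
  exists (P : diffop R d p n) (Q : diffop R d n p)
         (S : diffop R d m q) (T : diffop R d m n),
    (forall f : 'rV[R]_d -> 'cV[R]_n, smoothv [set: 'rV[R]_d] f ->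
       apply_fun B (apply_fun Q f) = apply_fun S (apply_fun A f)) /\
    (forall f : 'rV[R]_d -> 'cV[R]_n, smoothv [set: 'rV[R]_d] f ->
       forall x, apply_fun P (apply_fun Q f) x + apply_fun T (apply_fun A f) x
                 = f x).

Definition hypoelliptic (n m : nat) (A : diffop R d n m) : Prop :=
  forall Omega : set 'rV[R]_d, open Omega -> Omega !=set0 ->
  forall f : 'rV[R]_d -> 'cV[R]_m, smoothv Omega f ->
  forall u : 'I_n -> ('rV[R]_d -> R) -> R,
    (forall j, is_distribution Omega (u j)) ->
    dist_eq_fun Omega (apply_dist A u) f ->
  exists g : 'rV[R]_d -> 'cV[R]_n, smoothv Omega g /\ dist_eq_fun Omega u g.

End Operators.

(* Main.v *)
(** Write [A u = f].  Applying [Q] and using [B Q = S A], the distribution [Q u]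
    satisfies [B (Q u) = S f], so it is a smooth function [g] by
    hypoellipticity of [B]; then [u = P (Q u) + T (A u) = P g + T f].

    The two operator identities are assumed on smooth functions only.  Acting on
    distributions they amount to identities between formal transposes on test
    functions.  An integration by parts shows that both sides of such an
    identity have the same integral against every smooth function; taking their
    difference itself as the smooth function, the integral of a square vanishes,
    so the two sides coincide.

    Integration by parts rests on translation invariance: the difference
    quotients of a compactly supported [f] have integral zero and converge
    uniformly, on a bounded set, to the derivative of [f]. *)

Require Import Defs.
From mathcomp Require Import all_boot all_order all_algebra.
From mathcomp Require Import all_classical all_reals all_analysis.
From mathcomp Require Import ring lra.

Set Implicit Arguments.
Unset Strict Implicit.
Unset Printing Implicit Defensive.

Import Order.TTheory GRing.Theory Num.Theory.
Import numFieldNormedType.Exports.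

Local Open Scope classical_set_scope.
Local Open Scope ring_scope.

(** * Smooth functions and iterated partial derivatives *)

Section SmoothCalculus.
Context {R : realType} {d : nat}.
Implicit Types (f g : 'rV[R]_d -> R) (O : set 'rV[R]_d).

Lemma near_open O x (P : 'rV[R]_d -> Prop) :
  open O -> O x -> (forall y, O y -> P y) -> \forall y \near x, P y.
Proof. by move=> oO Ox OP; apply: filterS OP _; exact: open_nbhs_nbhs. Qed.

Lemma partial_eq O f g i x : open O -> O x -> (forall y, O y -> f y = g y) ->
  partial i f x = partial i g x.
Proof. by move=> oO Ox fg; apply: near_eq_derive; exact: (near_open oO Ox fg). Qed.

Lemma near_eq_continuous f g x : (\forall y \near x, f y = g y) ->
  {for x, continuous f} -> {for x, continuous g}.
Proof.
move=> fg cf; rewrite /prop_for /continuous_at -(nbhs_singleton fg).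
by apply: cvg_trans cf; exact: (@near_eq_cvg _ _ (nbhs x)).
Qed.

(** Total functions stand for functions on [O]. As [O] is open, continuity and derivatives at its
    points ignore values outside, and agreement on [O] passes to partial derivatives, which feeds
    the induction on [k]. *)
Lemma Ck_eq O k f g : open O -> (forall y, O y -> f y = g y) ->
  Ck O k f -> Ck O k g.
Proof.
move=> oO; elim: k f g => [|k IH] f g fg /= [cf df].
  by split=> // x Ox; apply: near_eq_continuous (cf x Ox); exact: near_open fg.
split=> [x Ox|i].
  by apply: near_eq_continuous (cf x Ox); exact: near_open fg.
have [di Ci] := df i; split=> [x Ox|].
  by apply: near_eq_derivable (di x Ox); exact: near_open fg.
by apply: IH Ci => y Oy; exact: partial_eq fg.
Qed.

Lemma CkS O k f : Ck O k.+1 f -> Ck O k f.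
Proof.
elim: k f => [|k IH] f; first by case.
move=> [cf df]; split=> // i; have [di Ci] := df i; split=> //; exact: IH.
Qed.

Lemma Ck_sub O O' k f : O' `<=` O -> Ck O k f -> Ck O' k f.
Proof.
move=> sO; elim: k f => [|k IH] f [cf df].
  by split=> // x /sO; exact: cf.
split=> [x /sO|i]; first exact: cf.
by have [di Ci] := df i; split; [move=> x /sO; exact: di|exact: IH].
Qed.

(** Every clause of [Ck] is a condition at single points, stated in their full neighbourhoods, so it
    can be checked on each set separately. This allows a product on [O] to be glued to zero off a
    compact set. *)
Lemma Ck_setU O O' k f : Ck O k f -> Ck O' k f -> Ck (O `|` O') k f.
Proof.
elim: k f => [|k IH] f [cf df] [cf' df'].
  by split=> // x [/cf|/cf'].
split=> [x [/cf|/cf']//|i].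
have [di Ci] := df i; have [di' Ci'] := df' i.
by split; [move=> x [/di|/di']|exact: IH].
Qed.

Lemma Ck_cst O k (c : R) : Ck O k (fun=> c).
Proof.
elim: k c => [|k IH] c.
  by split=> // x _; exact: cst_continuous.
split=> [x _|i]; first exact: cst_continuous.
split=> [x _|]; first exact: derivable_cst.
have -> : partial i (fun=> c) = fun=> 0 by apply/funext => x; exact: derive_cst.
exact: IH.
Qed.

Lemma partialD f g i x : derivable f x (delta_mx 0 i) ->
  derivable g x (delta_mx 0 i) ->
  partial i (fun y => f y + g y) x = partial i f x + partial i g x.
Proof. exact: deriveD. Qed.

Lemma partialM f g i x : derivable f x (delta_mx 0 i) ->
  derivable g x (delta_mx 0 i) ->
  partial i (fun y => f y * g y) x = f x * partial i g x + g x * partial i f x.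
Proof. exact: deriveM. Qed.

Lemma CkD O k f g : open O -> Ck O k f -> Ck O k g ->
  Ck O k (fun y => f y + g y).
Proof.
move=> oO; elim: k f g => [|k IH] f g [cf df] [cg dg].
  by split=> // x Ox; apply: continuousD; [exact: cf|exact: cg].
split=> [x Ox|i]; first by apply: continuousD; [exact: cf|exact: cg].
have [di Ci] := df i; have [dj Cj] := dg i.
split=> [x Ox|]; first by apply: derivableD; [exact: di|exact: dj].
apply: (@Ck_eq _ _ (fun x => partial i f x + partial i g x)) => //.
  by move=> x Ox; rewrite partialD//; [exact: di|exact: dj].
exact: IH.
Qed.

Lemma CkM O k f g : open O -> Ck O k f -> Ck O k g ->
  Ck O k (fun y => f y * g y).
Proof.
move=> oO; elim: k f g => [|k IH] f g.
  move=> [cf df] [cg dg]; split=> // x Ox.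
  by apply: continuousM; [exact: cf|exact: cg].
move=> Cf Cg; have [cf df] := Cf; have [cg dg] := Cg.
split=> [x Ox|i]; first by apply: continuousM; [exact: cf|exact: cg].
have [di Ci] := df i; have [dj Cj] := dg i.
split=> [x Ox|]; first by apply: derivableM; [exact: di|exact: dj].
apply: (@Ck_eq _ _ (fun x => f x * partial i g x + g x * partial i f x)) => //.
  by move=> x Ox; rewrite partialM//; [exact: di|exact: dj].
(* Leibniz's rule pairs derivatives with [f] and [g] themselves, whose extra order of regularity is
   given up by [CkS]. *)
by apply: CkD => //; apply: IH => //; exact: CkS.
Qed.

Lemma smooth_eq O f g : open O -> (forall y, O y -> f y = g y) ->
  smooth O f -> smooth O g.
Proof. by move=> oO fg sf k; exact: Ck_eq fg (sf k). Qed.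

Lemma smooth_sub O O' f : O' `<=` O -> smooth O f -> smooth O' f.
Proof. by move=> sO sf k; exact: Ck_sub (sf k). Qed.

Lemma smooth_setU O O' f : smooth O f -> smooth O' f -> smooth (O `|` O') f.
Proof. by move=> sf sf' k; exact: Ck_setU. Qed.

Lemma smooth_cst O (c : R) : smooth O (fun=> c).
Proof. by move=> k; exact: Ck_cst. Qed.

Lemma smoothD O f g : open O -> smooth O f -> smooth O g ->
  smooth O (fun y => f y + g y).
Proof. by move=> oO sf sg k; exact: CkD. Qed.

Lemma smoothM O f g : open O -> smooth O f -> smooth O g ->
  smooth O (fun y => f y * g y).
Proof. by move=> oO sf sg k; exact: CkM. Qed.

Lemma smoothZ O (c : R) f : open O -> smooth O f -> smooth O (fun y => c * f y).
Proof. by move=> oO sf; apply: smoothM => //; exact: smooth_cst. Qed.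

Lemma smooth_sum O (I : Type) (r : seq I) (P : pred I) (F : I -> 'rV[R]_d -> R) :
  open O -> (forall i, P i -> smooth O (F i)) ->
  smooth O (fun y => \sum_(i <- r | P i) F i y).
Proof.
move=> oO sF; elim: r => [|i r IH].
  by under eq_fun do rewrite big_nil; exact: smooth_cst.
under eq_fun do rewrite big_cons.
by case: (boolP (P i)) => // Pi; apply: smoothD => //; exact: sF.
Qed.

Lemma smooth_continuous O f x : smooth O f -> O x -> {for x, continuous f}.
Proof. by move=> /(_ 0) [cf _]; exact: cf. Qed.

Lemma smooth_derivable O f i x : smooth O f -> O x ->
  derivable f x (delta_mx 0 i).
Proof. by move=> /(_ 1)[_ /(_ i)[di _]]; exact: di. Qed.

Lemma smooth_partial O f i : smooth O f -> smooth O (partial i f).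
Proof. by move=> sf k; have [_ /(_ i)[]] := sf k.+1. Qed.

Lemma partial_cst (i : 'I_d) (c : R) :
  partial i (fun=> c) = (fun=> 0) :> ('rV[R]_d -> R).
Proof. by apply/funext => x; exact: derive_cst. Qed.

Lemma partialZ (c : R) f i x : derivable f x (delta_mx 0 i) ->
  partial i (fun y => c * f y) x = c * partial i f x.
Proof.
move=> df; have dc := derivable_cst c x (delta_mx 0 i : 'rV[R]_d).
by rewrite (partialM dc df) partial_cst mulr0 addr0.
Qed.

(** Derivatives along a list of directions, the head being applied last. Inductions can then peel
    off one direction at a time, which the multi-index form [partialX] does not offer. *)
Definition partials (s : seq 'I_d) f := foldr partial f s.

Lemma partials_cat s t f : partials (s ++ t) f = partials s (partials t f).
Proof. exact: foldr_cat. Qed.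

Lemma partials_eq O s f g x : open O -> O x -> (forall y, O y -> f y = g y) ->
  partials s f x = partials s g x.
Proof.
move=> oO + fg; elim: s x => [|i s IH] x Ox /=; first exact: fg.
by apply: partial_eq IH.
Qed.

Lemma smooth_partials O s f : smooth O f -> smooth O (partials s f).
Proof. by move=> sf; elim: s => //= i s; exact: smooth_partial. Qed.

Lemma partialsD O s f g x : open O -> smooth O f -> smooth O g -> O x ->
  partials s (fun y => f y + g y) x = partials s f x + partials s g x.
Proof.
move=> oO sf sg; elim: s x => [//|i s IH] x Ox /=.
rewrite (partial_eq _ oO Ox IH) partialD//;
  by apply: smooth_derivable Ox; exact: smooth_partials.
Qed.

Lemma partialsZ O s (c : R) f x : open O -> smooth O f -> O x ->
  partials s (fun y => c * f y) x = c * partials s f x.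
Proof.
move=> oO sf; elim: s x => [//|i s IH] x Ox /=.
rewrite (partial_eq _ oO Ox IH) partialZ//.
by apply: smooth_derivable Ox; exact: smooth_partials.
Qed.

Definition mindex_seq (a : 'I_d -> nat) : seq 'I_d :=
  flatten [seq nseq (a i) i | i <- enum 'I_d].

Lemma partialXE a f : partialX a f = partials (mindex_seq a) f.
Proof.
rewrite /partialX /mindex_seq; elim: (enum _) => //= i r IH.
rewrite partials_cat -IH; elim: (a i) => //= n ->//.
Qed.

Lemma size_mindex_seq a : size (mindex_seq a) = (\sum_i a i)%N.
Proof.
rewrite size_flatten /shape -map_comp sumnE big_map big_enum /=.
by apply: eq_bigr => i _; rewrite size_nseq.
Qed.

(** Together with the symmetry of derivatives, this identifies any [partials s] with some
    [partialX a], hence with a derivative that the seminorms of distributions control. *)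
Lemma perm_mindex_seq (s : seq 'I_d) :
  perm_eq s (mindex_seq (fun i => count_mem i s)).
Proof.
apply/allP => i _ /=; rewrite /mindex_seq count_flatten -map_comp sumnE big_map.
rewrite big_enum /= (bigD1 i)//= count_nseq /= eqxx mul1n big1 ?addn0// => j ji.
by rewrite count_nseq /= (negbTE ji).
Qed.

Lemma size_sum_count (s : seq 'I_d) : (\sum_i count_mem i s)%N = size s.
Proof. by rewrite -size_mindex_seq (perm_size (perm_mindex_seq s)). Qed.

End SmoothCalculus.

(** * Symmetry of second derivatives *)

Section MeanValue.
Context {R : realType} {V : normedModType R}.
Implicit Types (f : V -> R) (O : set V).

Lemma is_derive_line f (x v : V) (t : R) : derivable f (t *: v + x) v ->
  is_derive t 1 (fun s => f (s *: v + x)) ('D_v f (t *: v + x)).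
Proof.
move=> df.
have E : (fun h : R => h^-1 *: (f (h *: v + (t *: v + x)) - f (t *: v + x))) =
    (fun h => h^-1 *: ((fun s => f (s *: v + x)) (h *: 1 + t) -
      (fun s => f (s *: v + x)) t)).
  by apply/funext => h /=; rewrite addrA -scalerDl [h *: 1]mulr1.
by split; [move: df; rewrite /derivable/= E|rewrite /derive/= E].
Qed.

Lemma MVT_line f (x v : V) (a b : R) : a < b ->
  (forall c, a <= c <= b -> derivable f (c *: v + x) v) ->
  exists2 c, a < c < b &
    f (b *: v + x) - f (a *: v + x) = 'D_v f (c *: v + x) * (b - a).
Proof.
move=> ab df.
have dl c : a <= c <= b -> is_derive c 1 (fun s => f (s *: v + x))
    ('D_v f (c *: v + x)).
  by move=> /df; exact: is_derive_line.
have [||c cab ->] := @MVT R (fun s => f (s *: v + x))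
    (fun c => 'D_v f (c *: v + x)) a b ab.
- by move=> c; rewrite in_itv /= => /andP[ac cb]; apply: dl; rewrite !ltW.
- apply: derivable_within_continuous => c; rewrite in_itv /= => /dl [+ _].
  exact.
- by exists c.
Qed.

(** The left side is the increment along [v] of [g y = f (s *: w + y) - f y]. The mean value theorem
    for [g] along [v], then for ['D_v f] along [w], gives the two intermediate parameters. *)
Lemma second_difference f (x v w : V) (s : R) : 0 < s ->
  (forall a b, 0 <= a <= s -> 0 <= b <= s ->
     derivable f (a *: v + b *: w + x) v /\
     derivable ('D_v f) (a *: v + b *: w + x) w) ->
  exists a b, [/\ 0 <= a <= s, 0 <= b <= s &
    f (s *: v + s *: w + x) - f (s *: v + x) - (f (s *: w + x) - f x) =
    'D_w ('D_v f) (a *: v + b *: w + x) * s * s].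
Proof.
move=> s0 df.
have s00 : 0 <= (0 : R) <= s by rewrite lexx ltW.
have s0s : 0 <= s <= s by rewrite lexx ltW.
pose g y := f (s *: w + y) - f y.
have Es y : (fun h : R => h^-1 *: (f (s *: w + (h *: v + y)) - f (s *: w + y))) =
    (fun h => h^-1 *: (f (h *: v + (s *: w + y)) - f (s *: w + y))).
  by apply/funext => h; rewrite addrCA.
have dshift y : derivable f (s *: w + y) v ->
    derivable (fun z => f (s *: w + z)) y v.
  by rewrite /derivable/= Es.
have Dshift y : 'D_v (fun z => f (s *: w + z)) y = 'D_v f (s *: w + y).
  by rewrite /derive/= Es.
have df0 c : 0 <= c <= s -> derivable f (c *: v + x) v.
  by move=> cs; have [+ _] := df c 0 cs s00; rewrite scale0r addr0.
have dfs c : 0 <= c <= s -> derivable f (s *: w + (c *: v + x)) v.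
  by move=> cs; have [+ _] := df c s cs s0s; rewrite [_ *: v + _]addrC addrA.
have [c cs|a /andP[a0 a1]] := @MVT_line g x v 0 s s0.
  by apply: derivableB; [apply: dshift; exact: dfs|exact: df0].
have as_ : 0 <= a <= s by rewrite !ltW.
have -> : 'D_v g (a *: v + x) =
    'D_v f (s *: w + (a *: v + x)) - 'D_v f (a *: v + x).
  rewrite -Dshift; apply: deriveB; last exact: df0.
  by apply: dshift; exact: dfs.
have [c cs|b /andP[b0 b1]] := @MVT_line ('D_v f) (a *: v + x) w 0 s s0.
  by have [_] := df a c as_ cs; rewrite addrCA addrA.
rewrite !subr0 scale0r add0r => -> E; exists a, b; split; [exact: as_| |].
  by rewrite !ltW.
rewrite (_ : a *: v + b *: w + x = b *: w + (a *: v + x)); last first.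
  by rewrite addrCA addrA.
rewrite -E /g scale0r add0r; congr (f _ - _ - _).
by rewrite addrCA addrA.
Qed.

Lemma near_dist_lt f (x : V) (e : R) : {for x, continuous f} -> 0 < e ->
  \forall y \near x, `|f x - f y| < e.
Proof. by move=> cf e0; exact: (@cvgr_dist_lt _ _ _ (nbhs x)). Qed.

(** The second difference of side [s] is symmetric in [v] and [w]. Divided by [s * s], it is a value
    of each mixed derivative near [x], so by continuity the two differ at [x] by less than any
    [e]. *)
Lemma derive_comm f O (x v w : V) : open O -> O x ->
  (forall y, O y -> derivable f y v) -> (forall y, O y -> derivable f y w) ->
  (forall y, O y -> derivable ('D_v f) y w) ->
  (forall y, O y -> derivable ('D_w f) y v) ->
  {for x, continuous ('D_w ('D_v f))} -> {for x, continuous ('D_v ('D_w f))} ->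
  'D_w ('D_v f) x = 'D_v ('D_w f) x.
Proof.
move=> oO Ox dv dw dvw dwv cvw cwv.
apply/eqP; rewrite -subr_eq0 -normr_le0; apply/ler_addgt0Pl => e e0; rewrite addr0.
have e20 : 0 < e / 2 by rewrite divr_gt0.
have Nx : nbhs x O by exact: open_nbhs_nbhs.
have N1 : \forall y \near x, `|'D_w ('D_v f) x - 'D_w ('D_v f) y| < e / 2.
  exact: near_dist_lt cvw e20.
have N2 : \forall y \near x, `|'D_v ('D_w f) x - 'D_v ('D_w f) y| < e / 2.
  exact: near_dist_lt cwv e20.
have /nbhs_ballP[r /= r0 br] : nbhs x (O `&`
    ((fun y => `|'D_w ('D_v f) x - 'D_w ('D_v f) y| < e / 2) `&`
     (fun y => `|'D_v ('D_w f) x - 'D_v ('D_w f) y| < e / 2))).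
  exact: filterI Nx (filterI N1 N2).
(* The side [r / K] keeps the whole parallelogram inside the ball of radius [r]; the added [1] makes
   [K] positive even when [v] and [w] vanish. *)
pose K := `|v| + `|w| + 1.
have K0 : 0 < K by rewrite ltr_wpDl// addr_ge0.
pose s := r / K.
have s0 : 0 < s by rewrite divr_gt0.
have inb a b : 0 <= a <= s -> 0 <= b <= s -> ball x r (a *: v + b *: w + x).
  move=> /andP[a0 a1] /andP[b0 b1]; rewrite -ball_normE /= opprD addrCA subrr addr0.
  rewrite normrN; apply: (@le_lt_trans _ _ (s * (`|v| + `|w|))).
    apply: le_trans (ler_normD _ _) _; rewrite !normrZ mulrDr !ger0_norm//.
    by apply: lerD; apply: ler_wpM2r.
  rewrite /s mulrAC ltr_pdivrMr// ltr_pM2l// /K ltrDl//.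
have [a b a0 b0|a [b [as_ bs E1]]] := @second_difference f x v w s s0.
  have [Oy _] := br _ (inb _ _ a0 b0); split; [exact: dv|exact: dvw].
have inb' a' b' : 0 <= a' <= s -> 0 <= b' <= s -> ball x r (a' *: w + b' *: v + x).
  by move=> a0 b0; rewrite [a' *: w + _]addrC; exact: inb.
have [a' b' a0 b0|a' [b' [as'_ bs' E2]]] := @second_difference f x w v s s0.
  have [Oy _] := br _ (inb' _ _ a0 b0); split; [exact: dw|exact: dwv].
have [_ [L1 _]] := br _ (inb _ _ as_ bs).
have [_ [_ L2]] := br _ (inb' _ _ as'_ bs').
move: E1 E2 L1 L2; rewrite [s *: w + s *: v]addrC.
move: ('D_w ('D_v f) (a *: v + _ + _)) ('D_v ('D_w f) (a' *: w + _ + _)) => X Y.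
move: ('D_w ('D_v f) x) ('D_v ('D_w f) x) (f _) (f _) (f _) (f _).
move=> X0 Y0 f1 f2 f3 f4 E1 E2 L1 L2.
have E : X = Y.
  have s1 : s != 0 by rewrite gt_eqF.
  by apply: (mulIf s1); apply: (mulIf s1); rewrite -E1 -E2; ring.
rewrite -E in L2; rewrite ltW// (le_lt_trans (ler_distD X _ _))//.
by rewrite [e]splitr ltrD// distrC.
Qed.

End MeanValue.

Section Schwarz.
Context {R : realType} {d : nat}.
Implicit Types (f g : 'rV[R]_d -> R) (O : set 'rV[R]_d).

Lemma partial_comm O f i j x : open O -> smooth O f -> O x ->
  partial i (partial j f) x = partial j (partial i f) x.
Proof.
move=> oO sf Ox; apply: (derive_comm oO Ox).
- by move=> y; exact: smooth_derivable.
- by move=> y; exact: smooth_derivable.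
- by move=> y; apply: smooth_derivable; exact: (smooth_partial j sf).
- by move=> y; apply: smooth_derivable; exact: (smooth_partial i sf).
- by apply: smooth_continuous Ox; exact: (smooth_partial i (smooth_partial j sf)).
- by apply: smooth_continuous Ox; exact: (smooth_partial j (smooth_partial i sf)).
Qed.

Lemma partial_partials O f i s x : open O -> smooth O f -> O x ->
  partial i (partials s f) x = partials s (partial i f) x.
Proof.
move=> oO sf; elim: s x => [//|j s IH] x Ox /=.
rewrite -(partial_eq j oO Ox IH); apply: (partial_comm i j oO _ Ox).
exact: smooth_partials.
Qed.

(** The head of [s] is moved to the innermost place in both lists and absorbed into the function;
    the induction hypothesis then treats the remaining directions. *)
Lemma partials_perm O f s t x : open O -> smooth O f -> O x -> perm_eq s t ->
  partials s f x = partials t f x.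
Proof.
move=> oO + Ox; elim: s t f => [|i s IH] t f sf pst.
  by move: (perm_size pst); case: t {pst}.
have it : i \in t by rewrite -(perm_mem pst) mem_head.
case/splitPr: it pst => t1 t2 pst.
rewrite /= (partial_partials i s oO sf Ox) (IH (t1 ++ t2)); last 2 first.
- exact: smooth_partial.
- rewrite -(perm_cons i) (permPl pst) -[i :: t2]cat1s perm_catCA.
  exact: perm_refl.
rewrite !partials_cat; apply: (partials_eq _ oO Ox) => y Oy.
by rewrite /= (partial_partials i t2 oO sf Oy).
Qed.

End Schwarz.

(** * Integration of continuous functions with compact support *)

Section UniformContinuity.
Context {R : realType} {V : normedModType R}.

(** Only [x] is confined to [K]. Half of a radius of continuity at a point serves all centres in the
    half ball around it, and compactness, used as a near covering with radii tending to [0] from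
    above, gives a common radius. *)
Lemma compact_uniformly_continuous (K : set V) (f : V -> R) (e : R) :
  compact K -> continuous f -> 0 < e ->
  exists2 s, 0 < s & forall x y, K x -> `|x - y| < s -> `|f x - f y| < e.
Proof.
move=> cK cf e0; have e20 : 0 < e / 2 by rewrite divr_gt0.
pose P (s : R) x := forall y, `|x - y| < s -> `|f x - f y| < e.
have [s s0 Ps] : exists2 s : R, 0 < s & K `<=` P s.
  have /(_ _ (nbhs (0 : R)^'+) P _ _)[|s /= s0 sP] :=
      (compact_near_coveringP K).1 cK.
  - move=> x Kx; have /nbhs_ballP[r /= r0 rf] := near_dist_lt (cf x) e20.
    have r20 : 0 < r / 2 by rewrite divr_gt0.
    exists (ball x (r / 2), [set s | s < r / 2]) => /=.
      by split; [exact: nbhsx_ballx|exact: nbhs_right_lt].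
    move=> [z s] /= [xz sr] y zy.
    have zx : ball x r z by apply: le_ball xz; lra.
    have yx : ball x r y.
      move: xz; rewrite -!ball_normE /= => xz.
      rewrite (le_lt_trans (ler_distD z _ _))//.
      by rewrite [r]splitr ltrD// (lt_trans zy).
    rewrite (le_lt_trans (ler_distD (f x) _ _))// [e]splitr ltrD//; last exact: rf.
    by rewrite distrC; exact: rf.
  - exists (s / 2); first by rewrite divr_gt0.
    apply: sP => /=; last by rewrite divr_gt0.
    rewrite sub0r normrN gtr0_norm ?divr_gt0// ltr_pdivrMr// ltr_pMr//.
    by rewrite ltr1n.
by exists s => // x y Kx; exact: Ps.
Qed.

Lemma contracting_continuous (W : normedModType R) (g : V -> W) :
  (forall x y, `|g x - g y| <= `|x - y|) -> continuous g.
Proof.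
move=> gl x; apply/(@cvgrPdist_lt _ _ _ (nbhs x)) => e e0.
apply/nbhs_ballP; exists e => //= y; rewrite -ball_normE /= => xy.
exact: le_lt_trans (gl _ _) xy.
Qed.

End UniformContinuity.

(** * The maximum norm on row vectors split into a first coordinate and the rest *)

Section RowVectorNorm.
Context {R : realType}.

Lemma rV_norm_le n (x : 'rV[R]_n) (r : R) : 0 <= r ->
  (`|x| <= r) <-> (forall j, `|x 0 j| <= r).
Proof.
move=> r0; have -> : `|x| = mx_norm x by [].
rewrite mx_normrE; split.
  by move=> /bigmax_leP[_ h] j; exact: (h (0, j)).
by move=> h; apply/bigmax_leP; split=> // -[i j] _ /=; rewrite (ord1 i).
Qed.

Lemma norm_row_mx_le n (t : R) (y : 'rV[R]_n) (r : R) : 0 <= r ->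
  (`|row_mx (t%:M : 'rV[R]_1) y| <= r) <-> (`|t| <= r /\ `|y| <= r).
Proof.
move=> r0; rewrite !(rV_norm_le _ r0); split=> [h|[ht hy] j].
  split=> [|j]; first by have := h (lshift n 0); rewrite row_mxEl mxE eqxx.
  by have := h (rshift 1 j); rewrite row_mxEr.
rewrite mxE; case: splitP => k _; last exact: hy.
by rewrite (ord1 k) mxE eqxx.
Qed.

Lemma row_mx_eta n (x : 'rV[R]_n.+1) :
  x = row_mx ((x 0 0)%:M : 'rV[R]_1) (rsubmx (x : 'rV_(1 + n))).
Proof.
have -> : (x 0 0)%:M = lsubmx (x : 'rV_(1 + n)).
  apply/rowP => j; rewrite (ord1 j) !mxE eqxx mulr1n; congr (x _ _).
  exact/val_inj.
by rewrite hsubmxK.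
Qed.

Lemma norm_row_mxB n (t u : R) (y z : 'rV[R]_n) (e : R) : 0 <= e ->
  `|t - u| <= e -> `|y - z| <= e ->
  `|row_mx (t%:M : 'rV[R]_1) y - row_mx (u%:M : 'rV[R]_1) z| <= e.
Proof.
move=> e0 tu yz; rewrite opp_row_mx add_row_mx -raddfB.
by apply/norm_row_mx_le.
Qed.

End RowVectorNorm.

(** * Integrals on the line of continuous functions with bounded support *)

Section Integral1.
Context {R : realType}.
Implicit Types (F G : R -> R) (r M : R).
Local Notation mu := (@lebesgue_measure R).

Definition supp1 r F := continuous F /\ forall t, r < `|t| -> F t = 0.

Lemma fine_mu_itv (a b : R) : a <= b -> fine (mu `[a, b]%classic) = b - a.
Proof.
move=> ab; have E := @lebesgue_measure_itv R `[a, b].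
transitivity (fine (if (a%:E < b%:E)%E then b%:E - a%:E else 0)%E).
  by congr fine; exact: E.
rewrite lte_fin; case: ltgtP ab => // -> _ /=; by rewrite subrr.
Qed.

Lemma supp1_restrict r F : supp1 r F -> F \_ (`[- r, r]) = F.
Proof.
move=> [_ F0]; apply/funext => t; rewrite patchE; case: ifPn => //.
by rewrite notin_setE/= in_itv/= -ler_norml => /negP; rewrite -ltNge => /F0.
Qed.

Lemma supp1_integrable r F : supp1 r F -> mu.-integrable setT (EFin \o F).
Proof.
move=> sF; rewrite -(supp1_restrict sF) -restrict_EFin.
apply/(integrable_mkcond _ _).1; first exact: measurable_itv.
apply: continuous_compact_integrable; first exact: segment_compact.
by apply: continuous_subspaceT; have [] := sF.
Qed.

Lemma supp1_integralE r F : supp1 r F ->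
  \int[mu]_(t in [set: R]) F t = \int[mu]_(t in `[- r, r]) F t.
Proof. by move=> sF; rewrite [RHS]Rintegral_mkcond (supp1_restrict sF). Qed.

Lemma supp1_widen r s F : r <= s -> supp1 r F -> supp1 s F.
Proof. by move=> rs [cF F0]; split=> // t /(le_lt_trans rs); exact: F0. Qed.

Lemma supp1_shift r F h : supp1 r F -> supp1 (r + `|h|) (fun t => F (t + h)).
Proof.
move=> [cF F0]; split=> [t|t rt].
  apply: (@continuous_comp _ _ _ (fun t => t + h) F); last exact: cF.
  by apply: continuousD; [exact: cvg_id|exact: cst_continuous].
apply: F0; rewrite -(ltrD2r `|h|) (lt_le_trans rt)//.
by rewrite -{1}[t](addrK h) ler_normB.
Qed.

Lemma integral_lin r F G c : supp1 r F -> supp1 r G ->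
  \int[mu]_(t in [set: R]) (c * F t + G t) =
  c * \int[mu]_(t in [set: R]) F t + \int[mu]_(t in [set: R]) G t.
Proof.
move=> sF sG; have iF := supp1_integrable sF; have iG := supp1_integrable sG.
have icF : mu.-integrable setT (EFin \o (fun t => c * F t)).
  exact: (integrableZl _ c iF).
by rewrite RintegralD// RintegralZl.
Qed.

Lemma integral_bound r F M : 0 <= r -> supp1 r F -> (forall t, `|F t| <= M) ->
  `|\int[mu]_(t in [set: R]) F t| <= 2 * r * M.
Proof.
move=> r0 sF FM; rewrite (supp1_integralE sF).
have iF : mu.-integrable `[- r, r] (EFin \o F).
  by apply: integrableS (supp1_integrable sF) => //; exact: measurable_itv.
have ic : mu.-integrable `[- r, r] (EFin \o cst M).
  apply: continuous_compact_integrable; first exact: segment_compact.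
  by apply: continuous_subspaceT => ?; exact: cst_continuous.
apply: (le_trans (le_normr_Rintegral _ iF)); first exact: measurable_itv.
apply: (@le_trans _ _ (\int[mu]_(t in `[- r, r]) (cst M) t)).
  apply: le_Rintegral => //.
  by move: (integrable_abse iF).
rewrite Rintegral_cst; last exact: measurable_itv.
by rewrite fine_mu_itv ?opprK; lra.
Qed.

(** Substitution on [[- s, s]], where [s] is so large that both this interval and its translate by
    [h] contain the supports concerned; [|r|] covers a negative [r]. *)
Lemma integral_shift r F h : supp1 r F ->
  \int[mu]_(t in [set: R]) F (t + h) = \int[mu]_(t in [set: R]) F t.
Proof.
move=> sF; pose s := `|r| + `|h|.
have s0 : 0 <= s by rewrite addr_ge0.
have sFh : supp1 s (fun t => F (t + h)).
  by apply: supp1_widen (supp1_shift h sF); rewrite lerD2r ler_norm.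
rewrite (supp1_integralE sFh).
transitivity (\int[mu]_(t in `[- s + h, s + h]) F t).
  congr fine.
  have dF : derive1 (fun t : R => t + h) = cst 1.
    apply/funext => t; rewrite derive1E.
    exact: (congr1 (fun g => g t) (derive_shift 1 h)).
  rewrite (@integration_by_substitution_increasing _ (fun t => t + h) F (- s) s).
  - rewrite dF; apply: eq_integral => t _ /=.
    by rewrite /= mulr1.
  - by rewrite ge0_cp.
  - by move=> x y _ _ xy; rewrite ltrD2r.
  - by rewrite dF => x _; exact: cst_continuous.
  - by rewrite dF; exact: is_cvg_cst.
  - by rewrite dF; exact: is_cvg_cst.
  - have cs : continuous (fun t : R => t + h).
      by move=> t; apply: continuousD; [exact: cvg_id|exact: cst_continuous].
    split; [|exact/cvg_at_right_filter/cs|exact/cvg_at_left_filter/cs].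
    by move=> x _; apply: derivableD; [exact: derivable_id|exact: derivable_cst].
  - by apply: continuous_subspaceT; have [] := sF.
rewrite Rintegral_mkcond; congr (Rintegral _ _ _).
apply/funext => t; rewrite patchE; case: ifPn => //.
rewrite notin_setE/= in_itv/= => /negP nt; apply/esym; have [_ F0] := sF.
apply: F0; rewrite ltNge; apply: contra nt; rewrite ler_norml => /andP[t1 t2].
have r1 := ler_norm r; have h1 := ler_norm h; have h2 := ler_norm (- h).
by rewrite normrN in h2; rewrite /s; apply/andP; split; lra.
Qed.

(** If [F t] were positive, continuity would keep [F] above [F t / 2] on an interval of length [s]
    around [t], and the integral would be at least [F t / 2 * s]. *)
Lemma integral_eq0 r F : supp1 r F -> (forall t, 0 <= F t) ->
  \int[mu]_(t in [set: R]) F t = 0 -> forall t, F t = 0.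
Proof.
move=> sF F0 iF0 t; apply/eqP; rewrite eq_le F0 andbT leNgt; apply/negP => Ft.
have [cF _] := sF; have Ft2 : 0 < F t / 2 by rewrite divr_gt0.
have /nbhs_ballP[s /= s0 sB] := near_dist_lt (cF t) Ft2.
pose a := t - s / 2; pose b := t + s / 2.
have s20 : 0 < s / 2 by rewrite divr_gt0.
have FE x : `[a, b]%classic x -> F t / 2 <= F x.
  rewrite /= in_itv /= -ler_distlC => xt.
  have /sB : ball t s x.
    rewrite -ball_normE /= distrC (le_lt_trans _ (_ : s / 2 < s))// 1?distrC//.
    by rewrite ltr_pdivrMr// ltr_pMr// ltr1n.
  move=> /ltW; rewrite ler_distl => /andP[_]; lra.
have iF : mu.-integrable `[a, b] (EFin \o F).
  by apply: integrableS (supp1_integrable sF) => //; exact: measurable_itv.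
have : F t / 2 * s <= \int[mu]_(x in [set: R]) F x.
  apply: (@le_trans _ _ (\int[mu]_(x in `[a, b]) F x)).
    apply: (@le_trans _ _ (\int[mu]_(x in `[a, b]) cst (F t / 2) x)).
      rewrite Rintegral_cst; last exact: measurable_itv.
      rewrite fine_mu_itv /a /b; last lra.
      by rewrite (_ : t + s / 2 - (t - s / 2) = s); last lra.
    apply: le_Rintegral => //.
    apply: continuous_compact_integrable; first exact: segment_compact.
    by apply: continuous_subspaceT => ?; exact: cst_continuous.
  rewrite Rintegral_mkcond; apply: le_Rintegral => //.
  - rewrite -restrict_EFin; exact/(integrable_mkcond _ _).1.
  - exact: supp1_integrable sF.
  - by move=> x _; rewrite patchE; case: ifP.
by rewrite iF0 leNgt mulr_gt0.
Qed.

End Integral1.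

(** * Iterated integrals: linearity, bounds, positivity, translation invariance *)

Section IntegralRd.
Context {R : realType}.
Local Notation mu := (@lebesgue_measure R).

(** The radius stays explicit because slices inherit it and the bounds on integrals depend on it.
    The norm is the maximum norm, so the ball is a cube of side [2 * r]. *)
Definition supp_ball {d} (r : R) (f : 'rV[R]_d -> R) :=
  continuous f /\ forall x, r < `|x| -> f x = 0.

Definition slice d (f : 'rV[R]_d.+1 -> R) (t : R) : 'rV[R]_d -> R :=
  fun y => f (row_mx (t%:M : 'rV[R]_1) y).

Lemma integral_RdS d (f : 'rV[R]_d.+1 -> R) :
  integral_Rd f = \int[mu]_(t in [set: R]) integral_Rd (slice f t).
Proof. by []. Qed.

Lemma supp_ball_widen d r s (f : 'rV[R]_d -> R) : r <= s -> supp_ball r f ->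
  supp_ball s f.
Proof. by move=> rs [cF F0]; split=> // t /(le_lt_trans rs); exact: F0. Qed.

Lemma supp_ball0 d r : supp_ball r (fun _ : 'rV[R]_d => 0 : R).
Proof. by split=> // x; exact: cst_continuous. Qed.

Lemma supp_ball_lin d r c (f g : 'rV[R]_d -> R) : supp_ball r f ->
  supp_ball r g -> supp_ball r (fun x => c * f x + g x).
Proof.
move=> [cf f0] [cg g0]; split=> x.
  apply: (@continuousD R R _ (fun x => c * f x) g); last exact: cg.
  apply: (@continuousM R _ (fun=> c) f); last exact: cf.
  exact: cst_continuous.
by move=> rx; rewrite f0// g0// mulr0 addr0.
Qed.

Lemma supp_ball_shift d r (f : 'rV[R]_d -> R) v : supp_ball r f ->
  supp_ball (r + `|v|) (fun x => f (x + v)).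
Proof.
move=> [cf f0]; split=> x.
  have cv : {for x, continuous (fun x : 'rV[R]_d => x + v)}; last first.
    exact: (continuous_comp cv (cf _)).
  by apply: contracting_continuous => y z; rewrite opprD addrACA subrr addr0.
move=> rx; apply: f0; rewrite -(ltrD2r `|v|) (lt_le_trans rx)//.
by rewrite -{1}[x](addrK v) ler_normB.
Qed.

Lemma compact_closed_ball d (r : R) : compact [set x : 'rV[R]_d | `|x| <= r].
Proof.
apply: bounded_closed_compact.
  exists r; split; first exact: num_real.
  by move=> M rM x /= xr; rewrite (le_trans xr)// ltW.
have -> : [set x : 'rV[R]_d | `|x| <= r] = Num.norm @^-1` [set t | t <= r] by [].
by apply: preimage_closed; [move=> x _; exact: norm_continuous|exact: closed_le].
Qed.

(** Uniform continuity on the closed ball settles the case where one of the points lies in it; if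
    neither does, both values are zero. *)
Lemma supp_ball_uniform d r (f : 'rV[R]_d -> R) e : supp_ball r f -> 0 < e ->
  exists2 s, 0 < s & forall x y, `|x - y| < s -> `|f x - f y| < e.
Proof.
move=> [cf f0] e0.
have [s s0 sf] := compact_uniformly_continuous (@compact_closed_ball d r) cf e0.
exists s => // x y xy; case: (leP `|x| r) => [xr|xr]; first exact: sf.
case: (leP `|y| r) => [yr|yr]; last by rewrite !f0// subrr normr0.
by rewrite distrC; apply: sf => //; rewrite distrC.
Qed.

Lemma supp_ball_slice d r (f : 'rV[R]_d.+1 -> R) t : 0 <= r -> supp_ball r f ->
  supp_ball r (slice f t).
Proof.
move=> r0 [cf f0]; split=> y.
  have ct : {for y, continuous (fun y : 'rV[R]_d => row_mx (t%:M : 'rV[R]_1) y)};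
    last by exact: (continuous_comp ct (cf _)).
  apply: contracting_continuous => z w; apply: norm_row_mxB => //.
  by rewrite subrr normr0.
move=> ry; apply: f0; rewrite ltNge; apply/negP => /(norm_row_mx_le _ _ r0)[_].
by rewrite leNgt ry.
Qed.

Lemma slice0 d r (f : 'rV[R]_d.+1 -> R) t : 0 <= r -> supp_ball r f ->
  r < `|t| -> slice f t = fun=> 0.
Proof.
move=> r0 [_ f0] rt; apply/funext => y; apply: f0; rewrite ltNge; apply/negP.
by move=> /(norm_row_mx_le _ _ r0)[]; rewrite leNgt rt.
Qed.

(** Linearity and the bound by the volume of a cube go through the induction on [d] together: both
    are used in dimension [d] to see that integrals of slices depend continuously on [t], as the
    one-dimensional results require. *)
Let estimates d := forall r, 0 <= r ->
  (forall c (f g : 'rV[R]_d -> R), supp_ball r f -> supp_ball r g ->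
     integral_Rd (fun x => c * f x + g x) = c * integral_Rd f + integral_Rd g) /\
  (forall (f : 'rV[R]_d -> R) M, supp_ball r f -> (forall x, `|f x| <= M) ->
     `|integral_Rd f| <= (2 * r) ^+ d * M).

(** By linearity the difference of two slice integrals is the integral of a difference of slices,
    uniformly small by uniform continuity of [f]. *)
Let supp1_slice d r (f : 'rV[R]_d.+1 -> R) : estimates d -> 0 <= r ->
  supp_ball r f -> supp1 r (fun t => integral_Rd (slice f t)).
Proof.
move=> est r0 sf; have [lin bnd] := est r r0.
split=> [t|t rt]; last first.
  rewrite (slice0 r0 sf rt); apply/eqP; rewrite -normr_le0.
  have := bnd (fun=> 0) 0 (supp_ball0 _ r); rewrite mulr0; apply => x.
  by rewrite normr0.
apply/(@cvgrPdist_lt _ _ _ (nbhs t)) => e e0.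
(* The added [1] keeps the divisor positive when the cube has volume zero, and makes the final
   inequality strict. *)
pose C := (2 * r) ^+ d + 1.
have C0 : 0 < C by rewrite ltr_wpDl// exprn_ge0// mulr_ge0.
have [s s0 sfe] := supp_ball_uniform sf (divr_gt0 e0 C0).
apply/nbhs_ballP; exists s => //= u; rewrite -ball_normE /= => tu.
have st := supp_ball_slice t r0 sf; have su := supp_ball_slice u r0 sf.
rewrite addrC -mulN1r -lin//.
apply: (@le_lt_trans _ _ ((2 * r) ^+ d * (e / C))).
  apply: bnd; first exact: supp_ball_lin.
  move=> y; rewrite mulN1r addrC; apply/ltW/sfe.
  rewrite (le_lt_trans _ tu)//; apply: norm_row_mxB => //.
  by rewrite subrr normr0.
by rewrite mulrCA gtr_pMr// ltr_pdivrMr// mul1r /C ltrDl.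
Qed.

Let integral_Rd_estimates d : estimates d.
Proof.
elim: d => [|d IH] r r0.
  by split=> // f M _ fM /=; rewrite expr0 mul1r.
have [lin bnd] := IH r r0.
split=> [c f g sf sg|f M sf fM]; rewrite !integral_RdS.
  rewrite -(integral_lin c (supp1_slice IH r0 sf) (supp1_slice IH r0 sg)).
  congr (Rintegral _ _ _).
  by apply/funext => t; rewrite -lin//; exact: supp_ball_slice.
rewrite exprS -mulrA; apply: integral_bound => //; first exact: supp1_slice.
by move=> t; apply: bnd; [exact: supp_ball_slice|move=> y; exact: fM].
Qed.

Lemma integral_Rd_lin d r c (f g : 'rV[R]_d -> R) : 0 <= r ->
  supp_ball r f -> supp_ball r g ->
  integral_Rd (fun x => c * f x + g x) = c * integral_Rd f + integral_Rd g.
Proof. by move=> r0; have [+ _] := integral_Rd_estimates d r0; apply. Qed.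

Lemma integral_Rd_bound d r (f : 'rV[R]_d -> R) M : 0 <= r ->
  supp_ball r f -> (forall x, `|f x| <= M) ->
  `|integral_Rd f| <= (2 * r) ^+ d * M.
Proof. by move=> r0; have [_] := integral_Rd_estimates d r0; apply. Qed.

Lemma integral_Rd_0 d : integral_Rd (fun _ : 'rV[R]_d => 0 : R) = 0.
Proof.
apply/eqP; rewrite -normr_le0.
have := @integral_Rd_bound d 0 _ 0 (lexx 0) (supp_ball0 _ 0).
by rewrite mulr0; apply=> x; rewrite normr0.
Qed.

Lemma integral_Rd_ge0 d (f : 'rV[R]_d -> R) : (forall x, 0 <= f x) ->
  0 <= integral_Rd f.
Proof.
elim: d f => [|d IH] f f0 /=; first exact: f0.
by apply: Rintegral_ge0 => t _; apply: IH => y; exact: f0.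
Qed.

(** The integrals of slices are nonnegative and continuous in the first coordinate, so they vanish
    for every value of it, not merely almost every one, and the induction applies to each slice. *)
Lemma integral_Rd_eq0 d r (f : 'rV[R]_d -> R) : 0 <= r -> supp_ball r f ->
  (forall x, 0 <= f x) -> integral_Rd f = 0 -> forall x, f x = 0.
Proof.
move=> r0; elim: d f => [|d IH] f sf f0.
  by move=> /= If x; rewrite (_ : x = 0)//; apply/rowP => -[].
rewrite integral_RdS => If x; rewrite (row_mx_eta x).
have /(_ (x 0 0)) Ix := integral_eq0 (supp1_slice (@integral_Rd_estimates d) r0 sf)
  (fun t => integral_Rd_ge0 (fun y => f0 _)) If.
exact: (IH _ (supp_ball_slice (x 0 0) r0 sf) (fun y => f0 _) Ix).
Qed.

(** The outer integral is shifted by the first coordinate of [v], each slice by the remaining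
    ones. *)
Lemma integral_Rd_shift d r (f : 'rV[R]_d -> R) v : 0 <= r -> supp_ball r f ->
  integral_Rd (fun x => f (x + v)) = integral_Rd f.
Proof.
move=> r0; elim: d f v => [|d IH] f v sf.
  by rewrite /= (_ : 0 + v = 0)//; apply/rowP => -[].
rewrite !integral_RdS.
rewrite -(integral_shift (v 0 0) (supp1_slice (@integral_Rd_estimates d) r0 sf)).
congr (Rintegral _ _ _); apply/funext => t.
rewrite -(IH _ (rsubmx (v : 'rV_(1 + d))) (supp_ball_slice _ r0 sf)).
congr (integral_Rd _); apply/funext => y; rewrite /slice.
rewrite raddfD -(@add_row_mx _ 1 1 d); congr (f (_ + _)).
exact: row_mx_eta.
Qed.

(** A difference quotient of step [h] has integral zero by translation invariance. By the mean value
    theorem its value at [x] is one of ['D_v f] within distance [h * |v|] of [x], so uniform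
    continuity makes the integral of ['D_v f] smaller than any [e]. *)
Lemma integral_Rd_derive d r (f : 'rV[R]_d -> R) v : 0 <= r -> supp_ball r f ->
  (forall x, derivable f x v) -> continuous ('D_v f) ->
  integral_Rd ('D_v f) = 0.
Proof.
move=> r0 sf df cdf.
have [cf f0] := sf.
have sdf : supp_ball r ('D_v f).
  split=> // x rx; have <- : 'D_v (fun=> 0 : R) x = 0 by exact: derive_cst.
  apply: near_eq_derive; apply: (@filterS _ (nbhs x) _ [set y | r < `|y|]).
    by move=> y; exact: f0.
  apply: open_nbhs_nbhs; split=> //.
  have -> : [set y : 'rV[R]_d | r < `|y|] = Num.norm @^-1` [set t | r < t] by [].
  by apply: open_comp; [move=> y _; exact: norm_continuous|exact: open_gt].
pose s := r + `|v|; have s0 : 0 <= s by rewrite addr_ge0.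
have rs : r <= s by rewrite lerDl.
pose C := (2 * s) ^+ d + 1.
have C0 : 0 < C by rewrite ltr_wpDl// exprn_ge0// mulr_ge0.
apply/eqP; rewrite -normr_le0; apply/ler_addgt0Pl => e e0; rewrite addr0.
have [a a0 dfa] := supp_ball_uniform sdf (divr_gt0 e0 C0).
(* The bound [1] keeps the support of the translate in the ball of radius [s]; the other one puts
   the mean value point at distance less than [a]. *)
pose h := Num.min 1 (a / (`|v| + 1)).
have v1 : 0 < `|v| + 1 by rewrite ltr_wpDl.
have h0 : 0 < h by rewrite lt_min ltr01 divr_gt0.
have h1 : h <= 1 by rewrite ge_min lexx.
have ha : h * `|v| < a.
  rewrite (@le_lt_trans _ _ (a / (`|v| + 1) * `|v|))//.
    by rewrite ler_wpM2r// ge_min lexx orbT.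
  by rewrite mulrAC ltr_pdivrMr// ltr_pM2l// ltrDl.
have sfh : supp_ball s (fun x => f (x + h *: v)).
  apply: supp_ball_widen (supp_ball_shift _ sf); rewrite lerD2l normrZ gtr0_norm//.
  by rewrite ler_piMl.
have sf' := supp_ball_widen rs sf; have sdf' := supp_ball_widen rs sdf.
pose q x := h^-1 * (-1 * f x + f (x + h *: v)).
have sd : supp_ball s (fun x => -1 * f x + f (x + h *: v)) by exact: supp_ball_lin.
have q0 : integral_Rd (fun x => -1 * f x + f (x + h *: v)) = 0.
  by rewrite (integral_Rd_lin _ s0)// (integral_Rd_shift _ r0)// mulN1r addNr.
(* Subtracting the difference quotient, of integral zero, leaves an integrand that is uniformly
   small. *)
have -> : integral_Rd ('D_v f) =
    integral_Rd (fun x => - h^-1 * (-1 * f x + f (x + h *: v)) + 'D_v f x).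
  by rewrite (integral_Rd_lin _ s0)// q0 mulr0 add0r.
apply: (@le_trans _ _ ((2 * s) ^+ d * (e / C))).
  apply: integral_Rd_bound => //; first exact: supp_ball_lin.
  move=> x; have [c _|c /andP[c0 ch]] := MVT_line h0 (f := f) (x := x) (v := v).
    exact: df.
  rewrite subr0 scale0r add0r [_ *: _ + x]addrC => E.
  rewrite mulN1r [- f x + _]addrC E mulNr [_ * h]mulrC mulKf ?gt_eqF//.
  rewrite addrC; apply/ltW/dfa; rewrite opprD addrCA subrr addr0 normrN normrZ.
  by rewrite gtr0_norm// (le_lt_trans _ ha)// ler_wpM2r// ltW.
by rewrite mulrCA ger_pMr// ler_pdivrMr// mul1r /C lerDl.
Qed.

End IntegralRd.

(** * Test functions and integration by parts *)

Section TestFunctions.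
Context {R : realType} {d : nat}.
Implicit Types (K O : set 'rV[R]_d) (phi psi f : 'rV[R]_d -> R).

Lemma rV_compact_closed K : compact K -> closed K.
Proof. by apply: compact_closed; exact: norm_hausdorff. Qed.

Lemma smoothT_derivable phi i x : smooth setT phi ->
  derivable phi x (delta_mx 0 i).
Proof. by move=> /smooth_derivable; apply. Qed.

Lemma partials0 (s : seq 'I_d) : partials s (fun=> 0) = (fun=> 0 : R).
Proof. by elim: s => //= i s ->; rewrite partial_cst. Qed.

Lemma test_in_sub K K' phi : K `<=` K' -> test_in K phi -> test_in K' phi.
Proof. by move=> KK' [sp p0]; split=> // x K'x; apply: p0 => /KK'. Qed.

Lemma test_in0 K : test_in K (fun=> 0 : R).
Proof. by split=> //; exact: smooth_cst. Qed.

Lemma test_in_lin K (c : R) phi psi : test_in K phi -> test_in K psi ->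
  test_in K (fun x => c * phi x + psi x).
Proof.
move=> [sp p0] [sq q0]; split=> [|x Kx]; last by rewrite p0// q0// mulr0 addr0.
by apply: smoothD => //; [exact: openT|apply: smoothZ => //; exact: openT].
Qed.

Lemma test_inZ K (c : R) phi : test_in K phi -> test_in K (fun x => c * phi x).
Proof.
move=> tp; have := test_in_lin c tp (test_in0 K).
by under eq_fun do rewrite addr0.
Qed.

Lemma test_in_sum K (I : Type) (r : seq I) (P : pred I)
    (F : I -> 'rV[R]_d -> R) : (forall i, P i -> test_in K (F i)) ->
  test_in K (fun x => \sum_(i <- r | P i) F i x).
Proof.
move=> tF; split=> [|x Kx].
  by apply: smooth_sum => [|i Pi]; [exact: openT|have [] := tF i Pi].
by rewrite big1// => i Pi; have [_ ->] := tF i Pi.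
Qed.

Lemma test_in_partials K s phi : compact K -> test_in K phi ->
  test_in K (partials s phi).
Proof.
move=> /rV_compact_closed/closed_openC oK [sp p0].
split=> [|x Kx]; first exact: smooth_partials.
by rewrite (partials_eq s oK Kx p0) partials0.
Qed.

(** The values of [f] outside [O] are arbitrary, but the product is smooth on [O] and zero on the
    complement of [K], which is open, and these two sets cover the space. *)
Lemma test_in_mul O K f phi : open O -> compact K -> K `<=` O -> smooth O f ->
  test_in K phi -> test_in K (fun x => f x * phi x).
Proof.
move=> oO /rV_compact_closed/closed_openC oK KO sf [sp p0].
split=> [|x Kx]; last by rewrite p0// mulr0.
have -> : [set: 'rV[R]_d] = O `|` ~` K.
  by apply/esym/seteqP; split=> // x _; have [/KO|] := pselect (K x); [left|right].
apply: smooth_setU.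
  by apply: smoothM => //; apply: smooth_sub sp.
apply: (@smooth_eq _ _ _ (fun=> 0)) => //; last exact: smooth_cst.
by move=> x Kx; rewrite p0// mulr0.
Qed.

Lemma test_in_test O K phi : compact K -> K `<=` O -> test_in K phi ->
  test O phi.
Proof. by move=> cK KO tp; exists K. Qed.

Lemma test2 O phi psi : test O phi -> test O psi ->
  exists K, [/\ compact K, K `<=` O, test_in K phi & test_in K psi].
Proof.
move=> [K [cK KO tp]] [K' [cK' KO' tp']]; exists (K `|` K'); split.
- exact: compactU.
- by move=> x [/KO|/KO'].
- by apply: test_in_sub tp; left.
- by apply: test_in_sub tp'; right.
Qed.

Lemma testW O phi : test O phi -> test setT phi.
Proof. by move=> [K [cK KO tp]]; exists K. Qed.

Lemma test_lin O (c : R) phi psi : test O phi -> test O psi ->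
  test O (fun x => c * phi x + psi x).
Proof.
move=> tp tq; have [K [cK KO tp' tq']] := test2 tp tq.
by exists K; split=> //; exact: test_in_lin.
Qed.

Lemma test0 O : test O (fun=> 0 : R).
Proof. by exists set0; split=> //; [exact: compact0|exact: test_in0]. Qed.

Lemma test_sum O (I : Type) (r : seq I) (P : pred I)
    (F : I -> 'rV[R]_d -> R) : (forall i, P i -> test O (F i)) ->
  test O (fun x => \sum_(i <- r | P i) F i x).
Proof.
move=> tF; elim: r => [|i r IH].
  by under eq_fun do rewrite big_nil; exact: test0.
under eq_fun do rewrite big_cons.
have [Pi|_] := boolP (P i); last exact: IH.
have := test_lin 1 (tF i Pi) IH.
by under eq_fun do rewrite mul1r.
Qed.

Lemma test_mul O f phi : open O -> smooth O f -> test O phi ->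
  test O (fun x => f x * phi x).
Proof.
move=> oO sf [K [cK KO tp]]; exists K; split=> //.
exact: (test_in_mul oO).
Qed.

Lemma test_partials O s phi : test O phi -> test O (partials s phi).
Proof. by move=> [K [cK KO tp]]; exists K; split=> //; exact: test_in_partials. Qed.

Lemma compact_sub_ball K : compact K -> exists2 r : R, 0 <= r &
  forall x, K x -> `|x| <= r.
Proof.
move=> /compact_bounded[M [Mr MK]]; exists (`|M| + 1); first by rewrite addr_ge0.
by move=> x Kx; apply: MK => //; rewrite ltr_pwDr// ler_norm.
Qed.

Lemma test_supp_ball O phi : test O phi -> exists2 r, 0 <= r & supp_ball r phi.
Proof.
move=> [K [cK _ [sp p0]]]; have [r r0 Kr] := compact_sub_ball cK.
exists r => //; split=> [x|x rx]; first exact: (smooth_continuous sp I).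
by apply: p0 => /Kr; rewrite leNgt rx.
Qed.

Lemma continuous_bounded_ball f (r : R) : 0 <= r -> continuous f ->
  exists2 C, 0 <= C & forall x, `|x| <= r -> `|f x| <= C.
Proof.
move=> r0 cf; pose B := [set x : 'rV[R]_d | `|x| <= r].
have [||c _ fc] := @EVT_max_rV R d (fun x => `|f x|) B _ (@compact_closed_ball R d r).
- by exists 0; rewrite /B /= normr0.
- apply: continuous_subspaceT => x.
  have cx : {for x, continuous f} by exact: cf.
  exact: (continuous_comp cx (@norm_continuous _ _ (f x))).
- by exists `|f c| => // x xr; apply: fc; rewrite inE.
Qed.

Lemma test_bounded O phi : test O phi ->
  exists2 C, 0 <= C & forall x, `|phi x| <= C.
Proof.
move=> /test_supp_ball[r r0 [cp p0]].
have [C C0 pC] := continuous_bounded_ball r0 cp; exists C => // x.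
by have [/pC//|/p0->] := leP `|x| r; rewrite normr0.
Qed.

Lemma test_integral_lin O (c : R) phi psi : test O phi -> test O psi ->
  integral_Rd (fun x => c * phi x + psi x) = c * integral_Rd phi + integral_Rd psi.
Proof.
move=> /test_supp_ball[r r0 sp] /test_supp_ball[s s0 sq].
have rs : 0 <= Num.max r s by rewrite le_max r0.
apply: (integral_Rd_lin c rs); [apply: supp_ball_widen sp|apply: supp_ball_widen sq];
  by rewrite le_max lexx ?orbT.
Qed.

Lemma test_integral_partial O i phi : test O phi ->
  integral_Rd (partial i phi) = 0.
Proof.
move=> tp; have [r r0 sp] := test_supp_ball tp; have [K [cK _ [smp _]]] := tp.
apply: integral_Rd_derive r0 sp _ _ => x; first exact: smoothT_derivable.
exact: (smooth_continuous (smooth_partial i smp) I).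
Qed.

(** The derivative of the test function [f * phi] has integral zero. Leibniz's rule expands it at
    points of [K]; off [K] every term vanishes, whatever [f] does there. *)
Lemma integral_by_parts O f i phi : open O -> smooth O f -> test O phi ->
  integral_Rd (fun x => f x * partial i phi x) =
  - integral_Rd (fun x => partial i f x * phi x).
Proof.
move=> oO sf tp; have [K [cK KO tKp]] := tp.
have t1 : test O (fun x => f x * partial i phi x).
  by apply: test_mul => //; exact: (test_partials [:: i]).
have t2 : test O (fun x => partial i f x * phi x).
  by apply: test_mul => //; exact: smooth_partial.
apply/eqP; rewrite -addr_eq0 -[X in X + _]mul1r -(test_integral_lin _ t1 t2).
rewrite -(test_integral_partial i (test_mul oO sf tp)); apply/eqP.
congr integral_Rd; apply/funext => x; rewrite mul1r.
have [sp p0] := tKp.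
have [/KO Ox|Kx] := pselect (K x).
  rewrite partialM; first by rewrite [phi x * _]mulrC.
    exact: smooth_derivable Ox.
  exact: smoothT_derivable.
have [_ dp0] := test_in_partials [:: i] cK tKp.
have [_ dfp0] := test_in_partials [:: i] cK (test_in_mul oO cK KO sf tKp).
by rewrite p0// [partial i phi x]dp0// [RHS]dfp0// !mulr0 addr0.
Qed.

Lemma integral_by_parts_seq O f s phi : open O -> smooth O f -> test O phi ->
  integral_Rd (fun x => f x * partials s phi x) =
  (-1) ^+ size s * integral_Rd (fun x => partials s f x * phi x).
Proof.
move=> oO sf tp.
(* Moving the derivatives over one by one reverses their order, which the symmetry of derivatives
   then restores. *)
transitivity ((-1) ^+ size s * integral_Rd (fun x => partials (rev s) f x * phi x)).
  elim: s f sf => [|i s IH] f sf; first by rewrite mul1r.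
  rewrite /= (integral_by_parts i oO sf (test_partials s tp)).
  rewrite IH; last exact: smooth_partial.
  by rewrite exprS mulN1r mulNr rev_cons -cats1 partials_cat.
congr (_ * integral_Rd _); apply/funext => x; have [K [cK KO [_ p0]]] := tp.
have [/KO Ox|/p0->] := pselect (K x); last by rewrite !mulr0.
by rewrite (partials_perm oO sf Ox (permEl (perm_rev s))).
Qed.

End TestFunctions.

(** * Continuity estimates for distributions *)

Section BoundedOperators.
Context {R : realType} {d : nat}.
Implicit Types (K O : set 'rV[R]_d) (phi psi c : 'rV[R]_d -> R).

(** A substitute for the seminorms of [is_distribution] that mentions no supremum and so passes
    easily through sums, products and derivatives. [test_norm_bound] and [deriv_bound_test_norm]
    translate between the two. *)
Definition deriv_bound (N : nat) (M : R) phi :=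
  forall s : seq 'I_d, (size s <= N)%N -> forall x, `|partials s phi x| <= M.

Lemma deriv_boundW N N' M phi : (N <= N')%N -> deriv_bound N' M phi ->
  deriv_bound N M phi.
Proof. by move=> NN' b s sN; apply: b; exact: leq_trans NN'. Qed.

Lemma deriv_bound_ge0 N M phi : deriv_bound N M phi -> 0 <= M.
Proof. by move=> /(_ [::] isT 0); exact: le_trans. Qed.

Lemma deriv_bound_partials N M s phi : deriv_bound (N + size s) M phi ->
  deriv_bound N M (partials s phi).
Proof.
by move=> b t tN x; rewrite -partials_cat; apply: b; rewrite size_cat leq_add2r.
Qed.

Lemma deriv_boundD N M M' phi psi : smooth setT phi -> smooth setT psi ->
  deriv_bound N M phi -> deriv_bound N M' psi ->
  deriv_bound N (M + M') (fun x => phi x + psi x).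
Proof.
move=> sp sq bp bq s sN x; rewrite (partialsD s openT sp sq I).
by rewrite (le_trans (ler_normD _ _))// lerD ?bp ?bq.
Qed.

Lemma mul_test_bounded K c : compact K -> smooth setT c ->
  exists2 C, 0 <= C & forall N M phi x, test_in K phi -> deriv_bound N M phi ->
    `|c x * phi x| <= C * M.
Proof.
move=> cK sc; have [r r0 Kr] := compact_sub_ball cK.
have [C C0 cC] := @continuous_bounded_ball _ _ c r r0
  (fun x => smooth_continuous sc I).
exists C => // N M phi x [sp p0] b; have [/Kr xr|/p0->] := pselect (K x).
  by rewrite normrM ler_pM// ?cC// (b [::]).
by rewrite mulr0 normr0 mulr_ge0// (deriv_bound_ge0 b).
Qed.

(** Leibniz's rule, one derivative at a time: the last direction of the list is the innermost, and
    differentiating along it leaves two products to which bounds of order [N] apply. *)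
Lemma deriv_bound_mul K N c : compact K -> smooth setT c ->
  exists2 C, 0 <= C & forall M phi, test_in K phi -> deriv_bound N M phi ->
    deriv_bound N (C * M) (fun x => c x * phi x).
Proof.
move=> cK; elim: N c => [|N IH] c sc; have [C0 C00 B0] := mul_test_bounded cK sc.
  by exists C0 => // M phi tp b [|//] _ x; exact: B0 b.
have [C1 C10 B1] := IH c sc.
have /fin_all_exists2[D D0 BD] i := IH _ (smooth_partial i sc).
(* [C0] serves the empty list, [C1] the product of [c] with a derivative of [phi], and [D i] the
   product of [partial i c] with [phi]; summing over [i] gives one constant for all directions. *)
exists (C0 + C1 + \sum_i D i); first by rewrite !addr_ge0// sumr_ge0.
move=> M phi tp b s; have M0 := deriv_bound_ge0 b; have [sp _] := tp.
rewrite !mulrDl; elim/last_ind: s => [_|s i _]; last rewrite size_rcons ltnS => sN.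
  move=> x; rewrite -[leLHS]addr0 -[leLHS]addr0; apply: lerD; first apply: lerD.
  - exact: B0 b.
  - by rewrite mulr_ge0.
  - by rewrite mulr_ge0// sumr_ge0.
move=> x; rewrite -cats1 partials_cat /=.
have -> : partial i (fun x => c x * phi x) =
    (fun x => c x * partial i phi x + partial i c x * phi x).
  apply/funext => y; rewrite partialM; [|exact: smoothT_derivable..].
  by rewrite [phi y * _]mulrC.
have b' : deriv_bound N M phi by apply: deriv_boundW b.
have bi : deriv_bound N M (partial i phi).
  by apply: (@deriv_bound_partials _ _ [:: i]); rewrite addn1.
have tpi : test_in K (partial i phi) by exact: (test_in_partials [:: i]).
have := deriv_boundD _ _ (B1 M _ tpi bi) (BD i M _ tp b').
move=> /(_ _ _ s sN x) E; apply: (le_trans (E _ _)).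
- by apply: smoothM; [exact: openT|exact: sc|exact: smooth_partial].
- by apply: smoothM; [exact: openT|exact: smooth_partial|exact: sp].
apply: lerD; first by rewrite lerDr mulr_ge0.
by rewrite ler_wpM2r// (bigD1 i)//= lerDl sumr_ge0.
Qed.

(** Preservation of support, with the seminorm form of continuity on the Fréchet space of smooth
    functions supported in [K]. *)
Definition bounded_on_tests K (L : ('rV[R]_d -> R) -> 'rV[R]_d -> R) :=
  (forall phi, test_in K phi -> test_in K (L phi)) /\
  forall N, exists N' C, forall M phi, test_in K phi -> deriv_bound N' M phi ->
    deriv_bound N (C * M) (L phi).

Lemma bounded_on_tests_sum K (I : Type) (r : seq I) (P : pred I)
    (L : I -> ('rV[R]_d -> R) -> 'rV[R]_d -> R) :
  (forall i, P i -> bounded_on_tests K (L i)) ->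
  bounded_on_tests K (fun phi x => \sum_(i <- r | P i) L i phi x).
Proof.
move=> bL; split=> [phi tp|N].
  by apply: test_in_sum => i Pi; have [+ _] := bL i Pi; exact.
elim: r => [|i r [N1 [C1 B1]]].
  exists 0%N, 0 => M phi _ _ s _ x; under eq_fun do rewrite big_nil.
  by rewrite partials0 normr0 mul0r.
have [Pi|nPi] := boolP (P i); last first.
  exists N1, C1 => M phi tp b.
  by under eq_fun do rewrite big_cons (negbTE nPi); exact: B1.
have [ti /(_ N)[N2 [C2 B2]]] := bL i Pi.
exists (maxn N1 N2), (C2 + C1) => M phi tp b.
under eq_fun do rewrite big_cons Pi.
rewrite mulrDl; apply: deriv_boundD.
- by have [] := ti phi tp.
- apply: smooth_sum => [|k Pk]; first exact: openT.
  by have [+ _] := bL k Pk; move=> /(_ phi tp)[].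
- by apply: B2 => //; apply: deriv_boundW b; rewrite leq_maxr.
- by apply: B1 => //; apply: deriv_boundW b; rewrite leq_maxl.
Qed.

Lemma bounded_on_tests_diff K e s c : compact K -> smooth setT c ->
  bounded_on_tests K (fun phi x => e * partials s (fun y => c y * phi y) x).
Proof.
move=> cK sc; have tcp phi : test_in K phi -> test_in K (fun y => c y * phi y).
  exact: (test_in_mul openT cK (@subsetT _ K) sc).
split=> [phi tp|N]; first by apply: test_inZ; apply: test_in_partials; auto.
have [C C0 B] := deriv_bound_mul (N + size s) cK sc.
exists (N + size s)%N, (`|e| * C) => M phi tp b t tN x.
have [sp _] := test_in_partials s cK (tcp _ tp).
rewrite (partialsZ t e openT sp I) normrM -mulrA ler_wpM2l//.
exact: (deriv_bound_partials (B M phi tp b)).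
Qed.

Lemma sup_range_bound (f : 'rV[R]_d -> R) (M : R) : (forall x, `|f x| <= M) ->
  0 <= sup (range (fun x => `|f x|)) <= M.
Proof.
move=> fM; have ub : ubound (range (fun x => `|f x|)) M by move=> _ [x _ <-].
apply/andP; split; last by apply: ge_sup => //; exists `|f 0|; exists 0.
apply: (@le_trans _ _ `|f 0|) => //; apply: ub_le_sup; last by exists 0.
by exists M.
Qed.

Definition test_norm (N : nat) phi : R :=
  sum_mindex N (fun a => sup (range (fun x => `|partialX a phi x|))).

(** The cardinal counts the whole box of multi-indices, a crude bound for the number of those of
    length at most [N]. *)
Lemma test_norm_bound N M phi : deriv_bound N M phi ->
  `|test_norm N phi| <= #|{ffun 'I_d -> 'I_N.+1}|%:R * M.
Proof.
move=> b; have M0 := deriv_bound_ge0 b.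
rewrite (le_trans (ler_norm_sum _ _ _))//.
apply: (@le_trans _ _ (\sum_(a : {ffun 'I_d -> 'I_N.+1}) M)); last first.
  by rewrite sumr_const mulr_natl.
rewrite [leRHS](bigID (fun a : {ffun 'I_d -> 'I_N.+1} => (\sum_i a i <= N)%N))/=.
rewrite -[leLHS]addr0; apply: lerD; last by rewrite sumr_ge0.
apply: ler_sum => a aN.
set f := partialX _ _; have fM x : `|f x| <= M.
  by rewrite /f partialXE b// size_mindex_seq.
by have /andP[s0 sM] := sup_range_bound fM; rewrite ger0_norm.
Qed.

(** Counting occurrences in [s] gives a multi-index whose term in the sum dominates
    [partials s phi], the other terms being nonnegative. Compact support makes the suprema finite;
    [sup] of an unbounded set would bound nothing. *)
Lemma deriv_bound_test_norm K N phi : compact K -> test_in K phi ->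
  deriv_bound N (test_norm N phi) phi.
Proof.
move=> cK tp s sN x; have [sp _] := tp.
have bd (a : 'I_d -> nat) : exists M, forall x, `|partialX a phi x| <= M.
  rewrite partialXE; have tq := test_in_partials (mindex_seq a) cK tp.
  by have [C _ hC] := test_bounded (test_in_test cK (@subsetT _ K) tq); exists C.
have cN (i : 'I_d) : (count_mem i s < N.+1)%N.
  by rewrite ltnS (leq_trans (count_size _ _)).
pose a := [ffun i => Ordinal (cN i)] : {ffun 'I_d -> 'I_N.+1}.
have aE : (fun i => nat_of_ord (a i)) = (fun i => count_mem i s).
  by apply/funext => i; rewrite ffunE.
have aN : (\sum_i a i <= N)%N.
  rewrite (eq_bigr (fun i => count_mem i s)) ?size_sum_count// => i _.
  by rewrite ffunE.
rewrite /test_norm /sum_mindex (bigD1 a)//= -[leLHS]addr0; apply: lerD.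
  rewrite aE; have [M hM] := bd (fun i => count_mem i s).
  apply: ub_le_sup; first by exists M => _ [y _ <-].
  exists x => //; rewrite partialXE.
  by rewrite (partials_perm openT sp I (perm_mindex_seq s)).
apply: sumr_ge0 => b _; have [M hM] := bd (fun i => b i).
by have /andP[] := sup_range_bound hM.
Qed.

(** The algebraic half of [is_distribution], on which the calculus of transposes rests. *)
Definition test_linear O (u : ('rV[R]_d -> R) -> R) :=
  forall (e : R) phi psi, test O phi -> test O psi ->
    u (fun x => e * phi x + psi x) = e * u phi + u psi.

Lemma test_linear0 O u : test_linear O u -> u (fun=> 0) = 0.
Proof.
move=> lu; have := lu 1 _ _ (test0 O) (test0 O).
under eq_fun do rewrite mulr0 addr0.
by move/eqP; rewrite mul1r -subr_eq subrr eq_sym => /eqP.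
Qed.

Lemma test_linearZ O u e phi : test_linear O u -> test O phi ->
  u (fun x => e * phi x) = e * u phi.
Proof.
move=> lu tp; have := lu e _ _ tp (test0 O).
by under eq_fun do rewrite addr0; rewrite (test_linear0 lu) addr0.
Qed.

Lemma test_linear_sum O u (I : Type) (r : seq I) (P : pred I)
    (F : I -> 'rV[R]_d -> R) : test_linear O u ->
  (forall i, P i -> test O (F i)) ->
  u (fun x => \sum_(i <- r | P i) F i x) = \sum_(i <- r | P i) u (F i).
Proof.
move=> lu tF; elim: r => [|i r IH].
  by rewrite big_nil; under eq_fun do rewrite big_nil; exact: test_linear0 lu.
rewrite big_cons; under eq_fun do rewrite big_cons.
have [Pi|nPi] := boolP (P i); last exact: IH.
rewrite -IH; have := lu 1 _ _ (tF i Pi) (test_sum r tF).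
by under eq_fun do rewrite mul1r; rewrite mul1r.
Qed.

Lemma test_linear_integral O f : open O -> smooth O f ->
  test_linear O (fun phi => integral_Rd (fun x => f x * phi x)).
Proof.
move=> oO sf e phi psi tp tq; have tfp := test_mul oO sf tp.
rewrite -(test_integral_lin e tfp (test_mul oO sf tq)).
by congr integral_Rd; apply/funext => x; rewrite mulrDr mulrCA.
Qed.

Lemma is_distribution_comp_sum O n (L : 'I_n -> ('rV[R]_d -> R) -> 'rV[R]_d -> R)
    (u : 'I_n -> ('rV[R]_d -> R) -> R) (v : ('rV[R]_d -> R) -> R) :
  (forall j K, compact K -> bounded_on_tests K (L j)) ->
  (forall j e phi psi, test O phi -> test O psi ->
     L j (fun x => e * phi x + psi x) = (fun x => e * L j phi x + L j psi x)) ->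
  (forall j, is_distribution O (u j)) ->
  (forall phi, test O phi -> v phi = \sum_j u j (L j phi)) ->
  is_distribution O v.
Proof.
move=> bL linL du vE.
have tL j phi : test O phi -> test O (L j phi).
  move=> [K [cK KO tp]]; exists K; split=> //.
  by have [+ _] := bL j K cK; exact.
split=> [e phi psi tp tq|K cK KO].
  rewrite !vE//; last exact: test_lin.
  rewrite mulr_sumr -big_split /=; apply: eq_bigr => j _.
  by rewrite linL//; have [+ _] := du j; apply; exact: tL.
have bu j : exists X : nat * R, forall M phi, test_in K phi ->
    deriv_bound X.1 M phi -> `|u j (L j phi)| <= X.2 * M.
  have [_ /(_ K cK KO)[C [N uC]]] := du j.
  have [tLj /(_ N)[N' [D BD]]] := bL j K cK.
  (* The absolute value guards against a negative [C]; the cardinal comes from [test_norm_bound] and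
     [D] from the continuity of [L j]. *)
  exists (N', `|C| * #|{ffun 'I_d -> 'I_N.+1}|%:R * D) => M phi tp b /=.
  apply: (le_trans (uC _ (tLj _ tp))); apply: (le_trans (ler_norm _)).
  rewrite normrM -!mulrA ler_wpM2l//.
  exact: (test_norm_bound (BD M phi tp b)).
have [X BX] := fin_all_exists bu.
(* The seminorm of the largest order bounds the derivatives used for each [j], so the constants
   simply add up. *)
exists (\sum_j (X j).2), (\max_j (X j).1)%N => phi tp.
rewrite vE; last exact: (test_in_test cK KO tp).
rewrite (le_trans (ler_norm_sum _ _ _))// mulr_suml; apply: ler_sum => j _.
apply: BX => //; apply: deriv_boundW (deriv_bound_test_norm cK tp).
exact: (leq_bigmax j).
Qed.

End BoundedOperators.

(** * Formal transposes *)

Section Transposition.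
Context {R : realType} {d : nat}.
Implicit Types (K O : set 'rV[R]_d) (phi psi : 'rV[R]_d -> R).

(** An entry of the formal transpose: by [apply_distE], evaluating component [i] of [A u] at [phi]
    means summing the values of [u j] at [transpose A i j phi]. Identities between operators on
    distributions thus become identities between functions. *)
Definition transpose n m (A : diffop R d n m) (i : 'I_m) (j : 'I_n) phi :
    'rV[R]_d -> R :=
  fun x => sum_mindex (dorder A) (fun a => (-1) ^+ (\sum_k a k)%N *
    partialX a (fun y => dcoef A a y i j * phi y) x).

Lemma bounded_on_tests_transpose n m (A : diffop R d n m) i j K : compact K ->
  bounded_on_tests K (transpose A i j).
Proof.
move=> cK; have E : transpose A i j = (fun phi x =>
    \sum_(a : {ffun 'I_d -> 'I_(dorder A).+1} | (\sum_i a i <= dorder A)%N)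
     (-1) ^+ (\sum_k a k)%N * partials (mindex_seq (fun k => nat_of_ord (a k)))
       (fun y => dcoef A (fun k => nat_of_ord (a k)) y i j * phi y) x).
  apply/funext => phi; apply/funext => x; apply: eq_bigr => a _.
  by rewrite partialXE.
rewrite E; apply: bounded_on_tests_sum => a _; apply: bounded_on_tests_diff => //.
exact: smooth_dcoef.
Qed.

Lemma test_transpose n m (A : diffop R d n m) i j O phi : test O phi ->
  test O (transpose A i j phi).
Proof.
move=> [K [cK KO tp]]; exists K; split=> //.
by have [+ _] := bounded_on_tests_transpose A i j cK; exact.
Qed.

Lemma test_partialX_dcoef n m (A : diffop R d n m) i j a O phi : test O phi ->
  test O (partialX a (fun y => dcoef A a y i j * phi y)).
Proof.
move=> [K [cK KO tp]]; exists K; split=> //; rewrite partialXE.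
apply: test_in_partials => //.
by apply: (test_in_mul openT cK (@subsetT _ K)) tp; exact: smooth_dcoef.
Qed.

Lemma transpose_lin n m (A : diffop R d n m) i j O (e : R) phi psi :
  test O phi -> test O psi ->
  transpose A i j (fun x => e * phi x + psi x) =
  (fun x => e * transpose A i j phi x + transpose A i j psi x).
Proof.
move=> [K [_ _ [sp _]]] [K' [_ _ [sq _]]]; apply/funext => x.
rewrite /transpose /sum_mindex mulr_sumr -big_split /=; apply: eq_bigr => a _.
rewrite !partialXE; set b := fun k => nat_of_ord (a k).
have scp f : smooth setT f -> smooth setT (fun y => dcoef A b y i j * f y).
  by move=> sf; apply: smoothM => //; [exact: openT|exact: smooth_dcoef].
have -> : (fun y => dcoef A b y i j * (e * phi y + psi y)) =
    (fun y => e * (dcoef A b y i j * phi y) + dcoef A b y i j * psi y).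
  by apply/funext => y; rewrite mulrDr mulrCA.
rewrite (partialsD _ openT (smoothZ e openT (scp _ sp)) (scp _ sq) I).
by rewrite (partialsZ _ e openT (scp _ sp) I) mulrDr mulrCA.
Qed.

Lemma apply_distE n m (A : diffop R d n m) O (u : 'I_n -> ('rV[R]_d -> R) -> R)
    i phi : (forall j, test_linear O (u j)) -> test O phi ->
  apply_dist A u i phi = \sum_j u j (transpose A i j phi).
Proof.
move=> lu tp; rewrite /apply_dist /sum_mindex.
under eq_bigr do rewrite mulr_sumr.
rewrite exchange_big /=; apply: eq_bigr => j _.
rewrite /transpose /sum_mindex (test_linear_sum _ (lu j)) => [|a _].
  apply: eq_bigr => a _; rewrite (test_linearZ _ (lu j))//.
  exact: test_partialX_dcoef.
have := test_lin ((-1) ^+ (\sum_k a k)%N)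
  (test_partialX_dcoef A i j (fun k => nat_of_ord (a k)) tp) (test0 O).
by under eq_fun do rewrite addr0.
Qed.

Lemma is_distribution_apply_dist n m (A : diffop R d n m) O
    (u : 'I_n -> ('rV[R]_d -> R) -> R) i :
  (forall j, is_distribution O (u j)) -> is_distribution O (apply_dist A u i).
Proof.
move=> du; apply: (is_distribution_comp_sum (L := transpose A i) (u := u)) => //.
- by move=> j K; exact: bounded_on_tests_transpose.
- by move=> j e phi psi; exact: transpose_lin.
- by move=> phi; apply: apply_distE => j; have [] := du j.
Qed.

Lemma smoothv_apply_fun n m (A : diffop R d n m) O (g : 'rV[R]_d -> 'cV[R]_n) :
  open O -> smoothv O g -> smoothv O (apply_fun A g).
Proof.
move=> oO sg i.
have -> : (fun x => apply_fun A g x i 0) = (fun x =>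
    \sum_(a : {ffun 'I_d -> 'I_(dorder A).+1} | (\sum_i a i <= dorder A)%N)
    \sum_j dcoef A (fun k => nat_of_ord (a k)) x i j *
      partials (mindex_seq (fun k => nat_of_ord (a k))) (fun y => g y j 0) x).
  apply/funext => x; rewrite /apply_fun /sum_mindex summxE; apply: eq_bigr => a _.
  by rewrite mxE; apply: eq_bigr => j _; rewrite mxE partialXE.
apply: smooth_sum => // a _; apply: smooth_sum => // j _; apply: smoothM => //.
  by apply: smooth_sub (smooth_dcoef A _ i j).
exact: smooth_partials.
Qed.

(** The distributional and the classical actions agree: integration by parts yields a second sign
    [(-1) ^+ |a|], which cancels the one in [apply_dist]. *)
Lemma apply_dist_fun n m (A : diffop R d n m) O
    (u : 'I_n -> ('rV[R]_d -> R) -> R) (g : 'rV[R]_d -> 'cV[R]_n) :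
  open O -> smoothv O g -> dist_eq_fun O u g ->
  dist_eq_fun O (apply_dist A u) (apply_fun A g).
Proof.
move=> oO sg ug i phi tp.
pose c (a : {ffun 'I_d -> 'I_(dorder A).+1}) j x :=
  dcoef A (fun k => nat_of_ord (a k)) x i j.
pose dg (a : {ffun 'I_d -> 'I_(dorder A).+1}) j x :=
  partials (mindex_seq (fun k => nat_of_ord (a k))) (fun y => g y j 0) x.
have tc a j : test O (fun x => c a j x * phi x).
  by apply: test_mul => //; apply: smooth_sub (smooth_dcoef A _ i j).
have td a j : test O (fun x => dg a j x * (c a j x * phi x)).
  by apply: test_mul => //; apply: smooth_partials; exact: sg.
have lI : test_linear O (@integral_Rd R d).
  by move=> e f h; exact: test_integral_lin.
transitivity (integral_Rd (fun x =>
    \sum_(a : {ffun 'I_d -> 'I_(dorder A).+1} | (\sum_i a i <= dorder A)%N)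
    \sum_j dg a j x * (c a j x * phi x))); last first.
  congr integral_Rd; apply/funext => x.
  rewrite /apply_fun /sum_mindex summxE mulr_suml; apply: eq_bigr => a _.
  rewrite mxE mulr_suml; apply: eq_bigr => j _.
  by rewrite mxE partialXE [in RHS]mulrAC mulrC.
rewrite (test_linear_sum _ lI) => [|a _]; last by apply: test_sum => j _; exact: td.
rewrite /apply_dist /sum_mindex; apply: eq_bigr => a _.
rewrite (test_linear_sum _ lI) => [|j _]; last exact: td.
rewrite mulr_sumr; apply: eq_bigr => j _.
rewrite ug; last exact: test_partialX_dcoef.
rewrite partialXE (integral_by_parts_seq _ oO (sg j) (tc a j)) size_mindex_seq.
by rewrite mulrA -exprD -signr_odd addnn odd_double mul1r.
Qed.

(** Transposition reverses composition, so the transpose of [B] acts on [phi] first. *)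
Definition transpose_comp n p q (B : diffop R d p q) (Q : diffop R d n p)
    (i : 'I_q) (j : 'I_n) phi : 'rV[R]_d -> R :=
  fun x => \sum_l transpose Q l j (transpose B i l phi) x.

Lemma test_transpose_comp n p q (B : diffop R d p q) (Q : diffop R d n p) i j O
  phi : test O phi -> test O (transpose_comp B Q i j phi).
Proof. by move=> tp; apply: test_sum => l _; do 2 apply: test_transpose. Qed.

Lemma test_linear_apply_dist n m (A : diffop R d n m) O
    (u : 'I_n -> ('rV[R]_d -> R) -> R) i :
  (forall j, test_linear O (u j)) -> test_linear O (apply_dist A u i).
Proof.
move=> lu e phi psi tp tq; rewrite !(apply_distE _ _ lu)//; last exact: test_lin.
rewrite mulr_sumr -big_split /=; apply: eq_bigr => j _.
by rewrite (transpose_lin _ _ _ _ tp tq) lu//; exact: test_transpose.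
Qed.

Lemma apply_dist_comp n p q (B : diffop R d p q) (Q : diffop R d n p) O
    (u : 'I_n -> ('rV[R]_d -> R) -> R) i phi :
  (forall j, test_linear O (u j)) -> test O phi ->
  apply_dist B (apply_dist Q u) i phi = \sum_j u j (transpose_comp B Q i j phi).
Proof.
move=> lu tp; rewrite (@apply_distE _ _ _ O)//; last first.
  by move=> l; exact: test_linear_apply_dist.
under eq_bigr => l _ do rewrite (apply_distE Q l lu (test_transpose B i l tp)).
rewrite exchange_big /=; apply: eq_bigr => j _.
rewrite (test_linear_sum _ (lu j))// => l _.
by do 2 apply: test_transpose.
Qed.

(** Read [g] as the distribution it defines on the whole space; [apply_dist_fun], used for [Q] and
    then [B], reduces the claim to [apply_dist_comp]. *)
Lemma integral_apply_fun_comp n p q (B : diffop R d p q) (Q : diffop R d n p)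
    (g : 'rV[R]_d -> 'cV[R]_n) i phi : smoothv setT g -> test setT phi ->
  integral_Rd (fun x => apply_fun B (apply_fun Q g) x i 0 * phi x) =
  \sum_j integral_Rd (fun x => g x j 0 * transpose_comp B Q i j phi x).
Proof.
move=> sg tp; pose u j psi := integral_Rd (fun x => g x j 0 * psi x).
have ug : dist_eq_fun setT u g by [].
have uQ := apply_dist_fun Q openT sg ug.
have uB := apply_dist_fun B openT (smoothv_apply_fun Q openT sg) uQ.
rewrite -uB// (@apply_dist_comp _ _ _ _ _ setT)// => j.
by apply: test_linear_integral; [exact: openT|exact: sg].
Qed.

(* Test against g = (F j - G j) e_j. *)
Lemma integral_testing_eq n (F G : 'I_n -> 'rV[R]_d -> R) :
  (forall j, test setT (F j)) -> (forall j, test setT (G j)) ->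
  (forall g : 'rV[R]_d -> 'cV[R]_n, smoothv setT g ->
     \sum_j integral_Rd (fun x => g x j 0 * F j x) =
     \sum_j integral_Rd (fun x => g x j 0 * G j x)) ->
  forall j, F j = G j.
Proof.
move=> tF tG FG j; pose h x := -1 * G j x + F j x.
have th : test setT h by exact: test_lin.
have [K [cK _ [sh h0]]] := th.
pose g x : 'cV[R]_n := \col_k ((k == j)%:R * h x).
have sg : smoothv setT g.
  move=> k; under eq_fun do rewrite mxE.
  by apply: smoothZ => //; exact: openT.
have gE (H : 'I_n -> 'rV[R]_d -> R) :
    \sum_k integral_Rd (fun x => g x k 0 * H k x) =
    integral_Rd (fun x => h x * H j x).
  rewrite (bigD1 j)//= big1 ?addr0 => [|k kj].
    by congr integral_Rd; apply/funext => x; rewrite mxE eqxx mul1r.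
  under eq_fun do rewrite mxE (negbTE kj) !mul0r.
  exact: integral_Rd_0.
have := FG g sg; rewrite !gE => E.
have thh H : test setT H -> test setT (fun x => h x * H x).
  by apply: test_mul => //; exact: openT.
have hh : integral_Rd (fun x => h x * h x) = 0.
  have -> : (fun x => h x * h x) = (fun x => -1 * (h x * G j x) + h x * F j x).
    by apply/funext => x; rewrite {2}/h mulrDr mulrCA.
  by rewrite (test_integral_lin _ (thh _ (tG j)) (thh _ (tF j))) E mulN1r addNr.
have [r r0 sr] := test_supp_ball (thh h th).
apply/funext => x.
have /eqP := integral_Rd_eq0 r0 sr (fun y => sqr_ge0 (h y)) hh x.
rewrite mulf_eq0 orbb /h mulN1r addrC subr_eq0 => /eqP //.
Qed.

End Transposition.

(** * Transfer of hypoellipticity *)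

Theorem theorem3p17 (R : realType) (d n m p q : nat)
  (hd : (0 < d)%N) (hn : (0 < n)%N) (hm : (0 < m)%N)
  (hp : (0 < p)%N) (hq : (0 < q)%N)
  (A : diffop R d n m) (B : diffop R d p q) :
  differential_pretransmutation A B -> hypoelliptic B -> hypoelliptic A.
Proof.
move=> [P [Q [S [T [BQ PQT]]]]] hB O oO O0 f sf u du Auf.
have lu j : test_linear O (u j) by have [] := du j.
have smT (k l : nat) (C : diffop R d k l) g : smoothv setT g ->
    smoothv setT (apply_fun C g).
  by apply: smoothv_apply_fun; exact: openT.
(* The transposed form of [B Q = S A]: the hypothesis on smooth [g] makes the integrals of both
   sides against [g] equal. *)
have BQSA i j phi : test setT phi ->
    transpose_comp B Q i j phi = transpose_comp S A i j phi.
  move=> tp; apply: (integral_testing_eq (F := fun j => transpose_comp B Q i j phi)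
      (G := fun j => transpose_comp S A i j phi)) => [k|k|g sg].
  - exact: test_transpose_comp.
  - exact: test_transpose_comp.
  - by rewrite -!integral_apply_fun_comp// BQ.
(* The transposed form of [P Q + T A = Id], the identity being its own transpose, with Kronecker
   deltas as entries. *)
have PQTA i j phi : test setT phi ->
    (fun x => transpose_comp P Q i j phi x + transpose_comp T A i j phi x) =
    (fun x => (i == j)%:R * phi x).
  move=> tp; apply: (integral_testing_eq
    (F := fun j x => transpose_comp P Q i j phi x + transpose_comp T A i j phi x)
    (G := fun j x => (i == j)%:R * phi x)) => [k|k|g sg].
  - have := test_lin 1 (test_transpose_comp P Q i k tp) (test_transpose_comp T A i k tp).
    by under eq_fun do rewrite mul1r.
  - by apply: (test_mul openT) tp; exact: smooth_cst.
  have lg k : test_linear setT (fun psi => integral_Rd (fun x => g x k 0 * psi x)).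
    by apply: test_linear_integral; [exact: openT|exact: sg].
  transitivity (\sum_k (integral_Rd (fun x => g x k 0 * transpose_comp P Q i k phi x) +
      integral_Rd (fun x => g x k 0 * transpose_comp T A i k phi x))).
    apply: eq_bigr => k _.
    have := lg k 1 _ _ (test_transpose_comp P Q i k tp) (test_transpose_comp T A i k tp).
    by rewrite mul1r => <-; under [in RHS]eq_fun do rewrite mul1r.
  rewrite big_split /= -!integral_apply_fun_comp//.
  transitivity (integral_Rd (fun x => g x i 0 * phi x)).
    have := @test_integral_lin R d setT 1
      (fun x => apply_fun P (apply_fun Q g) x i 0 * phi x)
      (fun x => apply_fun T (apply_fun A g) x i 0 * phi x).
    rewrite mul1r => <-; first 1 last.
    - exact: (test_mul openT (smT _ _ P _ (smT _ _ Q _ sg) i) tp).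
    - exact: (test_mul openT (smT _ _ T _ (smT _ _ A _ sg) i) tp).
    congr integral_Rd; apply/funext => x; rewrite mul1r -mulrDl.
    by congr (_ * _); rewrite -(PQT g sg x) mxE.
  rewrite (bigD1 i)//= big1 ?addr0 => [|k ki].
    by congr integral_Rd; apply/funext => x; rewrite eqxx mul1r.
  rewrite eq_sym in ki; under eq_fun do rewrite (negbTE ki) mul0r mulr0.
  exact: integral_Rd_0.
have SAf := apply_dist_fun S oO sf Auf.
have [g [sg Qg]] : exists g, smoothv O g /\ dist_eq_fun O (apply_dist Q u) g.
  apply: (hB O oO O0 (apply_fun S f)).
  - exact: smoothv_apply_fun.
  - by move=> j; exact: is_distribution_apply_dist.
  - move=> i phi tp; rewrite -SAf// !(@apply_dist_comp _ _ _ _ _ _ _ O)//.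
    (* Test functions on [O] are test functions on the whole space, where the transposed identities
       were proved. *)
    by apply: eq_bigr => j _; rewrite BQSA//; exact: testW tp.
have PQg := apply_dist_fun P oO sg Qg; have TAf := apply_dist_fun T oO sf Auf.
have sPg := smoothv_apply_fun P oO sg; have sTf := smoothv_apply_fun T oO sf.
exists (fun x => apply_fun P g x + apply_fun T f x); split=> i.
  by under eq_fun do rewrite mxE; exact: smoothD.
move=> phi tp.
transitivity (apply_dist P (apply_dist Q u) i phi + apply_dist T (apply_dist A u) i phi).
  rewrite !(@apply_dist_comp _ _ _ _ _ _ _ O)// -big_split /=.
  (* The Kronecker delta isolates [u i phi]; each summand is then expanded by the transposed second
     identity and the linearity of [u j]. *)
  transitivity (\sum_j u j (fun x => (i == j)%:R * phi x)).
    rewrite (bigD1 i)//= big1 ?addr0 => [|j ji].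
      by congr (u i _); apply/funext => x; rewrite eqxx mul1r.
    rewrite eq_sym in ji; under eq_fun do rewrite (negbTE ji) mul0r.
    exact: test_linear0 (lu j).
  apply: eq_bigr => j _; rewrite -PQTA; last exact: testW tp.
  have := lu j 1 _ _ (test_transpose_comp P Q i j tp) (test_transpose_comp T A i j tp).
  by under eq_fun do rewrite mul1r; rewrite mul1r.
rewrite PQg// TAf//.
have := test_integral_lin 1 (test_mul oO (sPg i) tp) (test_mul oO (sTf i) tp).
rewrite mul1r => <-; congr integral_Rd; apply/funext => x.
by rewrite mul1r -mulrDl mxE.
Qed.
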